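(* For any smooth map $F:(S^m,g_{S^m})\to(S^n,g_{S^n})$ with $|dF|^2\leq \min(n,m)$ everywhere, $F$ is either an isometric embedding onto a great subsphere of $S^n$ or homotopically trivial.
   Context: $g_{S^m}$ denotes the standard round metric of constant curvature $1$ on the unit sphere $S^m$. $|dF|^2$ is the sum of the squares of the singular values of $dF$. A great subsphere of $S^n\subset\mathbb{R}^{n+1}$ is the intersection of $S^n$ with a linear subspace (possibly all of $S^n$). Homotopically trivial means homotopic to a constant map. *)

(* Defs.v *)
From HB Require Import structures.
From mathcomp Require Import all_boot all_order all_algebra.
From mathcomp Require Import all_classical all_reals all_analysis.
From mathcomp Require Import ring lra.

Set Implicit Arguments.
Unset Strict Implicit.
Unset Printing Implicit Defensive.

Import Order.TTheory GRing.Theory Num.Theory.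
Import numFieldNormedType.Exports.

Local Open Scope classical_set_scope.
Local Open Scope ring_scope.

(* The library norm on row vectors is the sup norm; it is used here only for
   its topology and for differentiation. Metric notions go through [dot]. *)
Definition dot {R : realType} {n : nat} (u v : 'rV[R]_n) : R :=
  \sum_(i < n) u 0 i * v 0 i.

Definition unit_sphere (R : realType) (n : nat) : set 'rV[R]_n.+1 :=
  [set x | dot x x = 1].
Arguments unit_sphere : clear implicits.

(* T_x S^n, as a subspace of the ambient space. *)
Definition tangent {R : realType} {n : nat} (x : 'rV[R]_n.+1) :
  set 'rV[R]_n.+1 := [set v | dot v x = 0].

Fixpoint Ck_on {R : realType} {p q : nat} (k : nat) (U : set 'rV[R]_p)
    (f : 'rV[R]_p -> 'rV[R]_q) : Prop :=
  match k with
  | 0 => forall x, U x -> {for x, continuous f}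
  | k'.+1 => (forall x, U x -> differentiable f x) /\
             (forall v : 'rV[R]_p, Ck_on k' U ('D_v f))
  end.

Definition smooth_on {R : realType} {p q : nat} (U : set 'rV[R]_p)
    (f : 'rV[R]_p -> 'rV[R]_q) : Prop := forall k, Ck_on k U f.

(* A map S^m -> S^n is represented by a function on the ambient spaces whose
   values off S^m are irrelevant. It is smooth when it is locally the
   restriction of a smooth map defined on an open subset of R^(m+1). *)
Definition smooth_sphere_map {R : realType} {m n : nat}
    (F : 'rV[R]_m.+1 -> 'rV[R]_n.+1) : Prop :=
  set_fun (unit_sphere R m) (unit_sphere R n) F /\
  forall x, unit_sphere R m x ->
    exists (U : set 'rV[R]_m.+1) (f : 'rV[R]_m.+1 -> 'rV[R]_n.+1),
      [/\ open U, U x, smooth_on U f &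
          forall y, U y -> unit_sphere R m y -> f y = F y].

Definition radial_proj {R : realType} {m : nat} (x : 'rV[R]_m.+1) :
  'rV[R]_m.+1 := (Num.sqrt (dot x x))^-1 *: x.

(* dF_x : T_x S^m -> T_F(x) S^n. The differential at x in S^m of the radial
   projection is the identity on T_x S^m, so on tangent vectors this is the
   differential of any local smooth extension of F (see [sphere_diffE]). It is
   meaningful only for v in [tangent x]. *)
Definition sphere_diff {R : realType} {m n : nat}
    (F : 'rV[R]_m.+1 -> 'rV[R]_n.+1) (x : 'rV[R]_m.+1) :
    'rV[R]_m.+1 -> 'rV[R]_n.+1 :=
  'd (F \o radial_proj) x.

(* The rows of E form an orthonormal basis of T_x S^m. *)
Definition tangent_frame {R : realType} {m : nat} (x : 'rV[R]_m.+1)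
    (E : 'M[R]_(m, m.+1)) : Prop :=
  (forall i, tangent x (row i E)) /\
  (forall i j, dot (row i E) (row j E) = (i == j)%:R).

(* s lists, with multiplicity, the singular values of dF_x: the nonnegative
   square roots of the eigenvalues of dF_x^* dF_x, an orthonormal eigenbasis
   being given by the rows of E. *)
Definition singular_values {R : realType} {m n : nat}
    (F : 'rV[R]_m.+1 -> 'rV[R]_n.+1) (x : 'rV[R]_m.+1) (s : 'rV[R]_m) : Prop :=
  (forall i, 0 <= s 0 i) /\
  exists E : 'M[R]_(m, m.+1), tangent_frame x E /\
    forall i j, dot (sphere_diff F x (row i E)) (sphere_diff F x (row j E)) =
                (s 0 i ^+ 2) *+ (i == j).

(* |dF|^2 at x; [singular_values_exist] and [sq_norm_diffE] show that the
   choice is always possible and that the result does not depend on it. *)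
Definition sq_norm_diff {R : realType} {m n : nat}
    (F : 'rV[R]_m.+1 -> 'rV[R]_n.+1) (x : 'rV[R]_m.+1) : R :=
  \sum_(i < m) (xget 0 [set s | singular_values F x s]) 0 i ^+ 2.

(* A smooth isometric embedding, for smooth F: F pulls the round metric of S^n
   back to that of S^m (hence is an immersion) and is a homeomorphism onto its
   image. *)
Definition isometric_embedding {R : realType} {m n : nat}
    (F : 'rV[R]_m.+1 -> 'rV[R]_n.+1) : Prop :=
  (forall x u v, unit_sphere R m x -> tangent x u -> tangent x v ->
     dot (sphere_diff F x u) (sphere_diff F x v) = dot u v) /\
  exists G : 'rV[R]_n.+1 -> 'rV[R]_m.+1,
    (forall x, unit_sphere R m x -> G (F x) = x) /\
    {within F @` unit_sphere R m, continuous G}.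

Definition great_subsphere {R : realType} {n : nat} (A : set 'rV[R]_n.+1) :
    Prop :=
  exists V : {vspace 'rV[R]_n.+1}, A = unit_sphere R n `&` [set y | y \in V].

Definition homotopically_trivial {R : realType} {m n : nat}
    (F : 'rV[R]_m.+1 -> 'rV[R]_n.+1) : Prop :=
  exists (H : R * 'rV[R]_m.+1 -> 'rV[R]_n.+1) (c : 'rV[R]_n.+1),
    [/\ {within `[0, 1]%classic `*` unit_sphere R m, continuous H},
        set_fun (`[0, 1]%classic `*` unit_sphere R m) (unit_sphere R n) H,
        forall x, unit_sphere R m x -> H (0, x) = F x &
        forall x, unit_sphere R m x -> H (1, x) = c].

Lemma dotE (R : realType) n (u v : 'rV[R]_n) : dot u v = (u *m v^T) 0 0.
Proof. by rewrite mxE; apply: eq_bigr => i _; rewrite !mxE. Qed.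

Lemma dotC (R : realType) n (u v : 'rV[R]_n) : dot u v = dot v u.
Proof. by apply: eq_bigr => i _; rewrite mulrC. Qed.

Lemma dotDl (R : realType) n (u v w : 'rV[R]_n) :
  dot (u + v) w = dot u w + dot v w.
Proof. by rewrite !dotE mulmxDl mxE. Qed.

Lemma dotZl (R : realType) n (a : R) (u v : 'rV[R]_n) :
  dot (a *: u) v = a * dot u v.
Proof. by rewrite !dotE -scalemxAl mxE. Qed.

Lemma dot_ge0 (R : realType) n (u : 'rV[R]_n) : 0 <= dot u u.
Proof. by apply: sumr_ge0 => i _; rewrite -expr2 sqr_ge0. Qed.

Lemma dot_eq0 (R : realType) n (u : 'rV[R]_n) : dot u u = 0 -> u = 0.
Proof.
move=> /eqP; rewrite psumr_eq0; last by move=> i _; rewrite -expr2 sqr_ge0.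
move=> /allP u0; apply/rowP => i; rewrite mxE.
by have /(_ (mem_index_enum i)) := u0 i; rewrite -expr2 /= sqrf_eq0 => /eqP.
Qed.

Lemma differentiable_dot (R : realType) n q (A B : 'M[R]_(n, q)) (x : 'rV[R]_n) :
  differentiable (fun v : 'rV[R]_n => dot (v *m A) (v *m B)) x.
Proof.
have dM (C : 'M[R]_(n, q)) i :
    differentiable (fun v : 'rV[R]_n => (v *m C) 0 i) x.
  rewrite (_ : (fun v => _) = \sum_j (fun v : 'rV[R]_n => C j i *: v 0 j)).
    apply: differentiable_sum => j; apply: differentiableZ.
    exact: differentiable_coord.
  by apply/funext => w; rewrite mxE fct_sumE; apply: eq_bigr => j _; rewrite mulrC.
rewrite (_ : (fun v => _) =
    \sum_i ((fun v : 'rV[R]_n => (v *m A) 0 i) * (fun v => (v *m B) 0 i))).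
  by apply: differentiable_sum => i; apply: differentiableM.
by apply/funext => w; rewrite fct_sumE.
Qed.

(* Among the unit vectors orthogonal to the rows of P, one maximizing the
   quadratic form G: it is G-orthogonal to the rest of that complement. *)
Lemma rayleigh_step (R : realType) N k (G : 'M[R]_N) (P : 'M[R]_(k, N)) :
    (k < N)%N -> G^T = G ->
  exists v : 'rV[R]_N, [/\ dot v v = 1, v *m P^T = 0 &
    forall w : 'rV[R]_N, w *m P^T = 0 -> dot v w = 0 -> dot (v *m G) w = 0].
Proof.
move=> kN symG.
have cdot q (A B : 'M[R]_(N, q)) :
    continuous (fun v : 'rV[R]_N => dot (v *m A) (v *m B)).
  by move=> v; apply/differentiable_continuous/differentiable_dot.
have normalize (u : 'rV[R]_N) : u != 0 ->
    exists2 a : R, a ^+ 2 * dot u u = 1 & a != 0.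
  move=> u0; have d0 : 0 < dot u u.
    by rewrite lt_def dot_ge0 andbT; apply: contraNN u0 => /eqP/dot_eq0 ->.
  exists (Num.sqrt (dot u u))^-1; last by rewrite invr_eq0 gt_eqF ?sqrtr_gt0.
  by rewrite exprVn sqr_sqrtr ?ltW// mulVf// gt_eqF.
pose A := [set v : 'rV[R]_N | dot v v = 1 /\ v *m P^T = 0].
have Ascale (u : 'rV[R]_N) a : a ^+ 2 * dot u u = 1 -> u *m P^T = 0 -> A (a *: u).
  move=> a1 uP; split; last by rewrite -scalemxAl uP scaler0.
  by rewrite dotZl dotC dotZl mulrA.
have A0 : A !=set0.
  have kr : kermx P^T != 0.
    by rewrite -mxrank_eq0 mxrank_ker mxrank_tr -lt0n subn_gt0
      (leq_ltn_trans (rank_leq_row P)).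
  have [|a a1 _] := normalize (nz_row (kermx P^T)); first by rewrite nz_row_eq0.
  by exists (a *: nz_row (kermx P^T)); apply: Ascale => //; apply/sub_kermxP/nz_row_sub.
have cA : compact A.
  apply: bounded_closed_compact.
    exists 1; split => // M M1 v [v1 _]; rewrite /= [leLHS]/Num.norm/= mx_normrE.
    apply/bigmax_leP; split => [|[i j] _ /=]; first by rewrite ltW// (lt_trans _ M1).
    rewrite (le_trans _ (ltW M1))// ord1 -(@ler_pXn2r _ 2)// ?nnegrE//.
    rewrite expr1n -normrX ger0_norm ?sqr_ge0// -v1 /dot (bigD1 j)//= expr2.
    by rewrite lerDl sumr_ge0// => l _; rewrite -expr2 sqr_ge0.
  have -> : A = (fun v : 'rV[R]_N => dot (v *m 1%:M) (v *m 1%:M)) @^-1` [set 1]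
              `&` (fun v : 'rV[R]_N => dot (v *m P^T) (v *m P^T)) @^-1` [set 0].
    apply/seteqP; split=> v /=; rewrite !mulmx1 => -[v1 vP]; split=> //.
      by rewrite vP dotE mul0mx mxE.
    exact: dot_eq0.
  by apply: closedI; (apply: preimage_closed; last exact: closed_eq) => y _;
    exact: cdot.
have [|v] := EVT_max_rV (f := fun v : 'rV[R]_N => dot (v *m G) (v *m 1%:M)) A0 cA.
  exact/continuous_subspaceT/cdot.
rewrite inE => -[v1 vP] vmax; exists v; split => // w wP vw.
have hom (u : 'rV[R]_N) : u *m P^T = 0 -> dot (u *m G) u <= dot (v *m G) v * dot u u.
  move=> uP; have [->|/normalize[a a1 a0]] := eqVneq u 0.
    by rewrite !dotE !mul0mx mxE mulr0.
  have /mem_set/vmax := Ascale _ _ a1 uP.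
  rewrite !mulmx1 -scalemxAl dotZl dotC dotZl dotC => ineq.
  rewrite -(@ler_pM2l _ (a ^+ 2)) ?exprn_even_gt0// [leRHS]mulrCA a1 mulr1.
  by rewrite expr2 -mulrA.
have GC (y z : 'rV[R]_N) : dot (y *m G) z = dot (z *m G) y.
  by rewrite dotC !dotE trmx_mul symG mulmxA.
set b := dot (v *m G) w; set c := dot (v *m G) v * dot w w - dot (w *m G) w.
have ineq t : t * (2 * b) <= t ^+ 2 * c.
  have := hom (v + t *: w).
  rewrite mulmxDl vP -scalemxAl wP scaler0 addr0 => /(_ erefl).
  rewrite mulmxDl -scalemxAl !(dotDl, dotZl) !(dotC _ (v + _)) !(dotDl, dotZl).
  rewrite (dotC w v) vw v1 !(dotC _ (_ *m G)) (GC w v) -/b /c; nra.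
pose d := `|c| + 1; have d0 : 0 < d by rewrite ltr_wpDl.
have cd : c < d by rewrite (le_lt_trans (ler_norm _))// ltrDl.
have := ineq (b / d).
rewrite -(@ler_pM2r _ (d ^+ 2)) ?exprn_gt0// => H.
have : b ^+ 2 * (2 * d - c) <= 0.
  rewrite -subr_ge0; rewrite -subr_ge0 in H; apply: le_trans H _.
  by rewrite le_eqVlt; apply/orP; left; apply/eqP; field; rewrite gt_eqF.
rewrite pmulr_lle0; last by lra.
by rewrite le_eqVlt ltNge sqr_ge0 orbF sqrf_eq0 => /eqP.
Qed.

Lemma mulmx_trE (R : realType) n k (w : 'rV[R]_n) (P : 'M[R]_(k, n)) i :
  (w *m P^T) 0 i = dot w (row i P).
Proof. by rewrite mxE; apply: eq_bigr => j _; rewrite !mxE. Qed.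

Lemma svd_frame (R : realType) m (G : 'M[R]_m.+1) (x : 'rV[R]_m.+1) k :
    G^T = G -> dot x x = 1 -> (k <= m)%N ->
  exists E : 'M[R]_(k, m.+1), [/\ forall i, dot (row i E) x = 0,
    forall i j, dot (row i E) (row j E) = (i == j)%:R,
    forall i j, i != j -> dot (row i E *m G) (row j E) = 0 &
    forall i w, dot w x = 0 -> (forall j, dot w (row j E) = 0) ->
      dot (row i E *m G) w = 0].
Proof.
move=> symG x1; elim: k => [_|k IHk km]; first by exists 0; split => -[].
have [E [Ex EE EG Ew]] := IHk (ltnW km).
have [v [v1 vP vw]] := rayleigh_step (col_mx x E) km symG.
have vx : dot v x = 0.
  have : dot v (row (lshift k ord0) (col_mx x E)) = 0 by rewrite -mulmx_trE vP mxE.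
  by rewrite rowKu row_id.
have vE i : dot v (row i E) = 0.
  have : dot v (row (rshift 1 i) (col_mx x E)) = 0 by rewrite -mulmx_trE vP mxE.
  by rewrite rowKd.
have {}vw w : dot w x = 0 -> (forall j, dot w (row j E) = 0) -> dot v w = 0 ->
    dot (v *m G) w = 0.
  move=> wx wE; apply: vw; apply/rowP => i; rewrite mulmx_trE mxE.
  have [j ->|j ->] := split_ordP i; rewrite ?rowKu ?rowKd//.
  by rewrite ord1 row_id.
have vGE i : dot (row i E *m G) v = 0 by exact: Ew.
have GC (y z : 'rV[R]_m.+1) : dot (y *m G) z = dot (z *m G) y.
  by rewrite dotC !dotE trmx_mul symG mulmxA.
pose E' : 'M[R]_(k.+1, m.+1) := \matrix_i oapp (fun j => row j E) v (unlift ord0 i).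
have r0 : row ord0 E' = v by rewrite rowK unlift_none.
have rS j : row (lift ord0 j) E' = row j E by rewrite rowK liftK.
exists E'; split.
- by move=> i; case: (unliftP ord0 i) => [j|] ->; rewrite ?r0 ?rS.
- move=> i j; case: (unliftP ord0 i) => [i'|] ->; case: (unliftP ord0 j) => [j'|] ->;
    rewrite !(r0, rS) ?eqxx//.
  by rewrite dotC vE eq_sym (negbTE (neq_lift _ _)).
- move=> i j; case: (unliftP ord0 i) => [i'|] ->; case: (unliftP ord0 j) => [j'|] ->;
    rewrite !(r0, rS) ?eqxx//.
  + by rewrite (inj_eq lift_inj); exact: EG.
  + by rewrite GC.
- move=> i w wx wE.
  have wv : dot w v = 0 by have := wE ord0; rewrite r0.
  have {}wE j : dot w (row j E) = 0 by have := wE (lift ord0 j); rewrite rS.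
  case: (unliftP ord0 i) => [j|] ->; rewrite ?r0 ?rS; last by apply: vw; rewrite // dotC.
  exact: Ew.
Qed.

Lemma frame_trace (R : realType) m (G : 'M[R]_m.+1) (x : 'rV[R]_m.+1) E :
    unit_sphere R m x -> tangent_frame x E ->
  \sum_i dot (row i E *m G) (row i E) = \tr G - dot (x *m G) x.
Proof.
move=> x1 [Ex EE].
pose O : 'M[R]_(1 + m) := col_mx x E.
have OO : O *m O^T = 1%:M.
  apply/row_matrixP => i; apply/rowP => j; rewrite row_mul mulmx_trE [RHS]mxE.
  rewrite [RHS]mxE.
  have [i' ->|i' ->] := split_ordP i; have [j' ->|j' ->] := split_ordP j;
    rewrite ?rowKu ?rowKd ?[i']ord1 ?[j']ord1 ?row_id.
  + by rewrite eqxx.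
  + by rewrite dotC Ex eq_lrshift.
  + by rewrite Ex eq_rlshift.
  + by rewrite EE eq_rshift.
have /(congr1 (fun A => \tr (A *m G))) := mulmx1C OO.
rewrite mul1mx -mulmxA mxtrace_mulC /mxtrace big_split_ord /= big_ord1 => <-.
have diag i : (O *m G *m O^T) i i = dot (row i O *m G) (row i O).
  by rewrite -mulmx_trE -!row_mul [RHS]mxE.
rewrite diag rowKu row_id [RHS]addrC addKr.
by apply: eq_bigr => i _; rewrite diag rowKd.
Qed.

Lemma dot_diffE (R : realType) m n (F : 'rV[R]_m.+1 -> 'rV[R]_n.+1) x v w
    (J := lin1_mx (sphere_diff F x)) :
  dot (sphere_diff F x v) (sphere_diff F x w) = dot (v *m (J *m J^T)) w.
Proof.
have mulJ u : u *m J = sphere_diff F x u by rewrite mul_rV_lin1.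
by rewrite -!mulJ !dotE trmx_mul !mulmxA.
Qed.

Lemma singular_values_exist (R : realType) m n
    (F : 'rV[R]_m.+1 -> 'rV[R]_n.+1) x :
  unit_sphere R m x -> exists s, singular_values F x s.
Proof.
move=> x1; set J := lin1_mx (sphere_diff F x).
have symG : (J *m J^T)^T = J *m J^T by rewrite trmx_mul trmxK.
have [E [Ex EE EG _]] := svd_frame symG x1 (leqnn m).
exists (\row_i Num.sqrt (dot (row i E *m (J *m J^T)) (row i E))); split.
  by move=> i; rewrite mxE sqrtr_ge0.
exists E; split => // i j; rewrite dot_diffE mxE sqr_sqrtr.
  by case: eqVneq => [->//|/EG].
by rewrite -dot_diffE dot_ge0.
Qed.

Lemma sq_norm_diffE (R : realType) m n (F : 'rV[R]_m.+1 -> 'rV[R]_n.+1) x E :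
    unit_sphere R m x -> tangent_frame x E ->
  sq_norm_diff F x =
  \sum_i dot (sphere_diff F x (row i E)) (sphere_diff F x (row i E)).
Proof.
rewrite /sq_norm_diff => x1 fE.
have [_ [E' [fE' EE']]] := xgetPex 0 (singular_values_exist F x1).
under [RHS]eq_bigr do rewrite dot_diffE.
rewrite (frame_trace _ x1 fE) -(frame_trace _ x1 fE').
by apply: eq_bigr => i _; rewrite -dot_diffE EE' eqxx.
Qed.

Lemma near_eq_diff (R : realType) (V W : normedModType R) (f g : V -> W) x :
  differentiable f x -> (\near x, f x = g x) -> 'd g x = 'd f x :> (V -> W).
Proof.
move=> df fg; have fgx : f x = g x by exact: nbhs_singleton fg.
apply: diff_unique; first exact: diff_continuous.
have /diff_locallyP[_ /eqaddoP dfo] := df.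
apply/eqaddoP => e e0.
move: fg; rewrite (near_shift 0) subr0 => fg.
near=> h.
have fgh : f (h + x) = g (h + x) by near: h; exact: fg.
suff : `|(f \o shift x - (cst (f x) + 'd f x)) h| <= e * `|id h|.
  by rewrite !fctE /= fgh fgx.
by near: h; exact: dfo.
Unshelve. all: by end_near. Qed.

Lemma radial_proj_diff (R : realType) m (x v : 'rV[R]_m.+1) :
    unit_sphere R m x -> tangent x v ->
  differentiable (@radial_proj R m) x /\ 'd (@radial_proj R m) x v = v.
Proof.
move=> x1 xv.
have dM (f g : 'rV[R]_m.+1 -> R) : differentiable f x -> differentiable g x ->
    'd (f * g) x v = f x * 'd g x v + g x * 'd f x v.
  by move=> df dg; rewrite diffM.
pose q := fun y : 'rV[R]_m.+1 => dot y y.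
have qE : q = \sum_i ((fun y : 'rV[R]_m.+1 => y 0 i : R) * (fun y : 'rV[R]_m.+1 => y 0 i : R)).
  by apply/funext => y; rewrite fct_sumE.
have dc (i : 'I_m.+1) : differentiable (fun y : 'rV[R]_m.+1 => y 0 i : R) x.
  exact: differentiable_coord.
have dcv (i : 'I_m.+1) : 'd (fun y : 'rV[R]_m.+1 => y 0 i : R) x v = v 0 i.
  have lc : linear (fun y : 'rV[R]_m.+1 => y 0 i : R) by move=> a y z; rewrite !mxE.
  pose lcM := GRing.isLinear.Build _ _ _ _ _ lc.
  pose L : {linear 'rV[R]_m.+1 -> R} := HB.pack (fun y : 'rV[R]_m.+1 => y 0 i : R) lcM.
  by rewrite -[fun y => _]/(L : _ -> _) diff_lin//; exact: coord_continuous.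
have dcc (i : 'I_m.+1) : differentiable ((fun y : 'rV[R]_m.+1 => y 0 i : R) * (fun y : 'rV[R]_m.+1 => y 0 i : R)) x.
  exact: differentiableM.
have dq : differentiable q x by rewrite qE; exact: differentiable_sum.
have dqv : 'd q x v = 0.
  rewrite -deriveE// qE derive_sum; last by move=> i; exact: diff_derivable.
  under eq_bigr do rewrite deriveE// dM// dcv.
  by move: xv; rewrite big_split/= /tangent/= dotC /dot => ->; rewrite addr0.
pose k := fun t : R => (Num.sqrt t)^-1.
have dk : differentiable k (q x).
  rewrite /q x1; apply/derivable1_diffP; apply: derivableV; first by rewrite sqrtr1 oner_eq0.
  by have [] := is_derive1_sqrt (@ltr01 R).
have dkq : differentiable (k \o q) x by exact: differentiable_comp.
have dkqv : 'd (k \o q) x v = 0 by rewrite diff_comp//= dqv linear0.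
pose g (i : 'I_m.+1) := (k \o q) * (fun y : 'rV[R]_m.+1 => y 0 i : R).
have dg i : differentiable (g i) x by exact: differentiableM.
have radialE : @radial_proj R m = \sum_i (fun y => g i y *: delta_mx 0 i).
  apply/funext => y; rewrite fct_sumE /radial_proj [X in _ *: X]row_sum_delta scaler_sumr.
  by apply: eq_bigr => i _; rewrite scalerA.
have dgZ i : differentiable (fun y => g i y *: (delta_mx 0 i : 'rV[R]_m.+1)) x.
  exact: differentiableZl.
have dr : differentiable (@radial_proj R m) x by rewrite radialE; exact: differentiable_sum.
split => //.
rewrite -deriveE// radialE derive_sum; last by move=> i; exact: diff_derivable.
rewrite [RHS]row_sum_delta; apply: eq_bigr => i _.
rewrite deriveE// diffZl// /g dM// dcv dkqv.
by rewrite /k/= /q x1 sqrtr1 invr1 mul1r mulr0 addr0.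
Qed.

Lemma sphere_diffE (R : realType) m n (F f : 'rV[R]_m.+1 -> 'rV[R]_n.+1)
    (U : set 'rV[R]_m.+1) x v :
    open U -> U x -> differentiable f x ->
    (forall y, U y -> unit_sphere R m y -> f y = F y) ->
    unit_sphere R m x -> tangent x v ->
  sphere_diff F x v = 'd f x v.
Proof.
move=> oU Ux df fF x1 xv.
have [dr drv] := radial_proj_diff x1 xv.
have rx : radial_proj x = x by rewrite /radial_proj x1 sqrtr1 invr1 scale1r.
have dfr : differentiable (f \o @radial_proj R m) x.
  by apply: differentiable_comp => //; rewrite rx.
have diffE : 'd f (radial_proj x) ('d (@radial_proj R m) x v) = 'd f x v.
  by rewrite rx drv.
have dfrx : differentiable f (radial_proj x) by rewrite rx.
have diff_fr := diff_comp dr dfrx.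
have Ur : \forall y \near x, U (radial_proj y).
  have /= := differentiable_continuous dr.
  by apply; rewrite rx; exact: open_nbhs_nbhs.
have y0 : \forall y \near x, dot y y > 0.
  have qE : (fun v : 'rV[R]_m.+1 => dot (v *m 1%:M) (v *m 1%:M)) = (fun v => dot v v).
    by apply/funext => y; rewrite mulmx1.
  have := differentiable_continuous (differentiable_dot 1%:M 1%:M x).
  by rewrite qE => /cvgr_gt; apply; rewrite x1.
have fFr : \forall y \near x, (f \o @radial_proj R m) y = (F \o @radial_proj R m) y.
  near=> y; apply: fF; first by near: y.
  have yn0 : 0 < dot y y by near: y.
  rewrite /unit_sphere/= /radial_proj dotZl dotC dotZl mulrA -expr2 exprVn.
  by rewrite sqr_sqrtr ?ltW// mulVf// gt_eqF.
have dFf := congr1 (fun h => h v) (near_eq_diff dfr fFr).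
exact: (etrans dFf (etrans (congr1 (fun h => h v) diff_fr) diffE)).
Unshelve. all: by end_near. Qed.

(* Main.v *)
Require Import Defs.
From HB Require Import structures.
From mathcomp Require Import all_boot all_order all_algebra.
From mathcomp Require Import all_classical all_reals all_analysis.
From mathcomp Require Import ring lra.

(** The bound enters in the form |dF|^2 <= m. Put d = m+1 and let
    f(y) = |y| F(y/|y|) be the extension of F to R^d that is homogeneous of
    degree one, so that |f(y)| = |y|. In the radial direction f is an isometry
    and in the directions tangent to the sphere its derivative is dF, whence
    |Df|^2 = 1 + |dF|^2 <= d away from the origin ([diff_hext_sqr]).

    Consider f averaged over Gaussian noise, U(s, c) = E f(c + s Z). The
    Gaussian Poincare inequality bounds the variance of f(c + s Z) by
    s^2 E |Df|^2 <= s^2 d, while E |f(c + s Z)|^2 = E |c + s Z|^2 =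
    |c|^2 + s^2 d. Hence |U(s, c)|^2 >= |c|^2. Consequently U(s, (1 - s) x)
    does not vanish for s < 1, and it does not vanish for s = 1 either unless
    equality holds in the Poincare inequality, that is, unless Df is constant.
    If Df is not constant, then U(s, (1 - s) x), rescaled to unit length, is a
    homotopy from F to a constant. If Df is constant, then by Euler's relation
    f is linear; being norm preserving it is a linear isometry, and F is its
    restriction to the sphere ([linear_great_isometry]).

    The Gaussian average is replaced by the N-fold iterate T^N of the average
    T g (y) over the 2d neighbours y + e_i, y - e_i of y, for one large N, so
    that only finite sums occur. This rests on four facts about such averages.
    - [poincare]: the variance of g under T^(N+1) is at most (N+1)/2 times the
      sum of T^N (Gamma g) and Gamma (T^N g), where Gamma g is the mean square
      increment of g. The first term dominates the second; their difference is
      the variance of the increments of g, so the inequality also quantifies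
      the gain for a nonconstant derivative.
    - [srw_energy_le]: the discrete energy Gamma f is at most 1 + eps far from
      the origin, by homogeneity and compactness of the sphere, and the walk
      rarely stays near the origin ([srw_origin_rare]).
    - [srw_ball_ge]: the walk reaches a ball of radius of order sqrt N at a
      distance of order sqrt N with a probability bounded below, so that two
      different values of Df produce a definite variance
      ([srw_variance_ge], [srw_energy_gap]).
    - [srw_nonvanishing]: therefore |T^(N+1) f (c)| > 0 for every c if Df is not
      constant and N is large.
    Using steps of size s in place of 1 provides the homotopy
    ([nonvanishing_homotopically_trivial]). *)

Import Order.TTheory GRing.Theory Num.Theory.
Import numFieldNormedType.Exports.

Set Implicit Arguments.
Unset Strict Implicit.
Unset Printing Implicit Defensive.
Local Open Scope classical_set_scope.
Local Open Scope ring_scope.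

(** * Averages over the steps of a random walk *)

Section RandomWalk.
Variables (R : realType) (V : zmodType) (I : finType) (X : I -> V).
Implicit Types (p w : I -> R) (g h : V -> R) (y z : V).

(** The action on functions of one step of the walk; general weights allow for
    changes of measure. *)
Definition walk w g y : R := \sum_a w a * g (y + X a).

Notation walkn w N := (iter N (walk w)).

Definition diffop a g y : R := g (y + X a) - g y.

Definition variance w g y : R := walk w (fun z => g z ^+ 2) y - walk w g y ^+ 2.

(** The carre du champ, a discrete squared length of the gradient. *)
Definition carre w g y : R := \sum_a w a * diffop a g y ^+ 2.

Lemma walk_le w g h : (forall a, 0 <= w a) -> (forall y, g y <= h y) ->
  forall y, walk w g y <= walk w h y.
Proof. by move=> w0 gh y; apply: ler_sum => a _; apply: ler_wpM2l. Qed.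

Lemma walkn_le w N g h : (forall a, 0 <= w a) -> (forall y, g y <= h y) ->
  forall y, walkn w N g y <= walkn w N h y.
Proof. by move=> w0 gh; elim: N => //= N IH; apply: walk_le. Qed.

Lemma walk_lin w (b c : R) g h :
  walk w (fun y => b * g y + c * h y) = fun y => b * walk w g y + c * walk w h y.
Proof.
apply/funext => y; rewrite /walk !mulr_sumr -big_split /=.
by apply: eq_bigr => a _; ring.
Qed.

Lemma walkn_lin w N (b c : R) g h :
  walkn w N (fun y => b * g y + c * h y) =
  fun y => b * walkn w N g y + c * walkn w N h y.
Proof. by elim: N => //= N ->; rewrite walk_lin. Qed.

Lemma walknZ w N (b : R) g :
  walkn w N (fun y => b * g y) = fun y => b * walkn w N g y.
Proof.
have := walkn_lin w N b 0 g g; under eq_fun do rewrite mul0r addr0.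
by move=> ->; apply/funext => y; rewrite mul0r addr0.
Qed.

Lemma walknB w N g h :
  walkn w N (fun y => g y - h y) = fun y => walkn w N g y - walkn w N h y.
Proof.
have := walkn_lin w N 1 (-1) g h; under eq_fun do rewrite mul1r mulN1r.
by move=> ->; apply/funext => y; rewrite mul1r mulN1r.
Qed.

Lemma walknD w N g h :
  walkn w N (fun y => g y + h y) = fun y => walkn w N g y + walkn w N h y.
Proof.
have := walkn_lin w N 1 1 g h; under eq_fun do rewrite !mul1r.
by move=> ->; apply/funext => y; rewrite !mul1r.
Qed.

Lemma walkn_sum w N (J : finType) (g : J -> V -> R) :
  walkn w N (fun y => \sum_j g j y) = fun y => \sum_j walkn w N (g j) y.
Proof.
elim: N => //= N ->; apply/funext => y; rewrite /walk exchange_big /=.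
by apply: eq_bigr => a _; rewrite mulr_sumr.
Qed.

Lemma walkn_shift w N g v y : walkn w N (fun z => g (z + v)) y = walkn w N g (y + v).
Proof.
elim: N y => //= N IH y; apply: eq_bigr => a _.
by rewrite IH addrAC.
Qed.

Lemma diffop_walkn w N a g : diffop a (walkn w N g) = walkn w N (diffop a g).
Proof. by rewrite /diffop walknB; apply/funext => y; rewrite walkn_shift. Qed.

Lemma walkZ w (b : R) g : walk w (fun y => b * g y) = fun y => b * walk w g y.
Proof. exact: (@walknZ w 1). Qed.

Lemma walkB w g h : walk w (fun y => g y - h y) = fun y => walk w g y - walk w h y.
Proof. exact: (@walknB w 1). Qed.

Lemma walkD w g h : walk w (fun y => g y + h y) = fun y => walk w g y + walk w h y.
Proof. exact: (@walknD w 1). Qed.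

Lemma walk_sum w (J : finType) (g : J -> V -> R) :
  walk w (fun y => \sum_j g j y) = fun y => \sum_j walk w (g j) y.
Proof. exact: (@walkn_sum w 1). Qed.

Lemma walk_shift w g v y : walk w (fun z => g (z + v)) y = walk w g (y + v).
Proof. exact: (@walkn_shift w 1). Qed.

Lemma diffop_walk w a g : diffop a (walk w g) = walk w (diffop a g).
Proof. exact: (@diffop_walkn w 1). Qed.

Section Probability.
Variable p : I -> R.
Hypotheses (p0 : forall a, 0 <= p a) (p1 : \sum_a p a = 1).

Lemma walk_cst (c : R) : walk p (fun=> c) = fun=> c.
Proof. by apply/funext => y; rewrite /walk -mulr_suml p1 mul1r. Qed.

Lemma walkn_cst N (c : R) : walkn p N (fun=> c) = fun=> c.
Proof. by elim: N => //= N ->; rewrite walk_cst. Qed.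

(** As a sum of squares of differences, one for each pair of steps, the
    variance is visibly positive and visibly convex in [g]. *)
Lemma varianceE g y : variance p g y =
  2^-1 * \sum_a \sum_b p a * p b * (g (y + X a) - g (y + X b)) ^+ 2.
Proof.
have -> : \sum_a \sum_b p a * p b * (g (y + X a) - g (y + X b)) ^+ 2 =
  \sum_a \sum_b (p b * (p a * g (y + X a) ^+ 2)) +
  \sum_a \sum_b (p a * (p b * g (y + X b) ^+ 2)) -
  2 * \sum_a \sum_b (p a * g (y + X a) * (p b * g (y + X b))).
  rewrite mulr_sumr -sumrN -!big_split /=; apply: eq_bigr => a _.
  rewrite mulr_sumr -sumrN -!big_split /=; apply: eq_bigr => b _; ring.
under eq_bigr do rewrite -mulr_suml p1 mul1r.
under [X in _ + X - _]eq_bigr do rewrite -mulr_sumr.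
rewrite -mulr_suml p1 mul1r -big_distrlr /= /variance /walk; by field.
Qed.

Lemma variance_ge0 g y : 0 <= variance p g y.
Proof.
rewrite varianceE mulr_ge0 ?invr_ge0 ?ler0n //.
apply: sumr_ge0 => a _; apply: sumr_ge0 => b _.
by rewrite mulr_ge0 ?sqr_ge0 ?mulr_ge0.
Qed.

Lemma variance_ge_pair g y a b : a != b ->
  p a * p b * (g (y + X a) - g (y + X b)) ^+ 2 <= variance p g y.
Proof.
move=> ab; rewrite varianceE.
have S0 c d : 0 <= p c * p d * (g (y + X c) - g (y + X d)) ^+ 2.
  by rewrite mulr_ge0 ?sqr_ge0 ?mulr_ge0.
set s := p a * p b * _.
have sa : s <= \sum_d p a * p d * (g (y + X a) - g (y + X d)) ^+ 2.
  by rewrite (bigD1 b) //= lerDl sumr_ge0.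
have sb : s <= \sum_d p b * p d * (g (y + X b) - g (y + X d)) ^+ 2.
  rewrite (bigD1 a) //= /s (mulrC (p a)) -sqrrN opprB lerDl sumr_ge0 //.
rewrite [leLHS](_ : s = 2^-1 * (s + s)); last by field.
rewrite ler_wpM2l ?invr_ge0 ?ler0n // (bigD1 a) //= [X in _ <= _ + X](bigD1 b) 1?eq_sym //= addrA.
apply: ler_wpDr; last exact: lerD.
by apply: sumr_ge0 => c _; apply: sumr_ge0.
Qed.

Lemma walkn_sqr_le N g y : walkn p N g y ^+ 2 <= walkn p N (fun z => g z ^+ 2) y.
Proof.
elim: N y => //= N IH y; apply: le_trans (walk_le p0 IH y).
by rewrite -subr_ge0; apply: variance_ge0.
Qed.

Lemma variance_shift g (c : R) y :
  variance p g y = walk p (fun z => (g z - c) ^+ 2) y - (walk p g y - c) ^+ 2.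
Proof.
have -> : walk p (fun z => (g z - c) ^+ 2) y =
  walk p (fun z => g z ^+ 2) y - (2 * c) * walk p g y + c ^+ 2.
  rewrite [X in _ + X](_ : _ = \sum_a p a * c ^+ 2); last by rewrite -mulr_suml p1 mul1r.
  rewrite /walk mulr_sumr -sumrN -!big_split /=.
  by apply: eq_bigr => a _; ring.
rewrite /variance; ring.
Qed.

Lemma variance_le_carre g y : variance p g y <= carre p g y.
Proof. by rewrite (variance_shift g (g y)) gerBl sqr_ge0. Qed.

(** Each difference in [varianceE] commutes with the average, so that Jensen's
    inequality applies to its square. *)
Lemma variance_walk_le g y : variance p (walk p g) y <= walk p (variance p g) y.
Proof.
rewrite varianceE.
rewrite (_ : variance p g = fun z => 2^-1 * \sum_a \sum_b
  p a * p b * (g (z + X a) - g (z + X b)) ^+ 2); last first.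
  by apply/funext => z; exact: varianceE.
rewrite walkZ ler_wpM2l ?invr_ge0 ?ler0n //.
rewrite walk_sum; apply: ler_sum => a _.
rewrite walk_sum; apply: ler_sum => b _.
rewrite walkZ /= ler_wpM2l ?mulr_ge0 //.
have /= := walkn_sqr_le 1 (fun z => g (z + X a) - g (z + X b)) y.
by rewrite [X in X ^+ 2 <= _ -> _](_ : _ = walk p g (y + X a) - walk p g (y + X b));
  last by rewrite walkB /= !walk_shift.
Qed.

Lemma carreE g : carre p g = fun y => \sum_a p a * diffop a g y ^+ 2.
Proof. by []. Qed.

Lemma walkn_carre N g :
  walkn p N (carre p g) =
  fun y => \sum_a p a * walkn p N (fun z => diffop a g z ^+ 2) y.
Proof.
by rewrite carreE walkn_sum; apply/funext => y; apply: eq_bigr => a _; rewrite walknZ.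
Qed.

Lemma carre_walkn_le N g y : carre p (walkn p N g) y <= walkn p N (carre p g) y.
Proof.
rewrite carreE walkn_carre; apply: ler_sum => a _; rewrite ler_wpM2l //.
by rewrite diffop_walkn walkn_sqr_le.
Qed.

(** By [variance_walk_le], averaging first decreases the variance of each
    increment of [g]: along [k], the quantities
    [walkn p (n - k) (carre p (walkn p k g))] form a convex sequence. *)
Lemma carre_convex g y : 2 * walkn p 1 (carre p (walk p g)) y <=
  walkn p 2 (carre p g) y + carre p (walkn p 2 g) y.
Proof.
have VV h z : 2 * walk p (fun x => walk p h x ^+ 2) z <=
    walkn p 2 (fun x => h x ^+ 2) z + walkn p 2 h z ^+ 2.
  have := variance_walk_le h z.
  rewrite /variance walkB /=; lra.
rewrite !(walkn_carre 1) !(walkn_carre 2) [carre p _]carreE mulr_sumr -big_split /=.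
apply: ler_sum => a _; rewrite mulrCA -mulrDr ler_wpM2l //.
by have := VV (diffop a g) y; rewrite /= -!diffop_walk.
Qed.

(** The chord inequality for that convex sequence, between its end points and
    its last but one term. *)
Lemma carre_chord N g y :
  N.+1%:R * walk p (carre p (walkn p N g)) y <=
  walkn p N.+1 (carre p g) y + N%:R * carre p (walkn p N.+1 g) y.
Proof.
elim: N y => [|N IH] y; first by rewrite mul1r mul0r addr0.
have := walk_le p0 IH y; rewrite walkZ walkD walkZ => {}IH.
have := ler_wpM2l (ler0n R N.+1) (carre_convex (walkn p N g) y).
rewrite /= in IH *.
rewrite -!natr1 in IH *; lra.
Qed.

(** Each step contributes to the variance at most one of the terms
    [walkn p (N - k) (carre p (walkn p k g))] with [k <= N], and a convex
    sequence is on average at most the mean of its end points. Bounding all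
    terms by the first one would give the usual inequality; the last one
    records what is lost when the increments of [g] are not constant. *)
Lemma poincare N g y :
  walkn p N.+1 (fun z => g z ^+ 2) y - walkn p N.+1 g y ^+ 2 <=
  N.+1%:R / 2 * (walkn p N (carre p g) y + carre p (walkn p N g) y).
Proof.
elim: N y => [|N IH] y.
  have := variance_le_carre g y; rewrite /= /variance; lra.
have /= := walk_le p0 IH y.
rewrite walkB walkZ walkD /= => {}IH.
have := variance_le_carre (walkn p N.+1 g) y; rewrite /= /variance.
have /= := carre_chord N g y.
rewrite -[N.+2%:R]natr1; lra.
Qed.

(** The total variance is at most [B] and is a sum of [N + 1] terms, each of
    which is, by Jensen's inequality, at least [p a * p b] times the squared
    difference of the final average. *)
Lemma smoothing N g (B : R) a b y : a != b -> (forall z, g z ^+ 2 <= B) ->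
  N.+1%:R * (p a * p b * (walkn p N g (y + X a) - walkn p N g (y + X b)) ^+ 2) <= B.
Proof.
move=> ab gB.
pose D h z := h (z + X a) - h (z + X b).
have DT M h z : D (walkn p M h) z = walkn p M (D h) z.
  by rewrite /D walknB !walkn_shift.
suff lb : forall z, N.+1%:R * (p a * p b * D (walkn p N g) z ^+ 2) <=
    walkn p N.+1 (fun z => g z ^+ 2) z - walkn p N.+1 g z ^+ 2.
  apply: le_trans (lb y) _; rewrite lerBlDr (@le_trans _ _ B) //; last by rewrite lerDl sqr_ge0.
  by apply: le_trans (walkn_le N.+1 p0 gB y) _; rewrite walkn_cst.
elim: N => [z|N IH z].
  by rewrite mul1r; apply: variance_ge_pair.
have := walk_le p0 IH z.
rewrite walkZ walkZ walkB /= => {}IH.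
have := variance_ge_pair (walkn p N.+1 g) z ab; rewrite -/(D (walkn p N.+1 g) z) /variance /=.
have /= J := walkn_sqr_le 1 (D (walkn p N g)) z.
have /= DE := DT 1%N (walkn p N g) z; rewrite -DE in J.
have pp : 0 <= p a * p b by rewrite mulr_ge0.
have := ler_wpM2l (ler0n R N.+1) (ler_wpM2l pp J).
rewrite -[N.+2%:R]natr1 mulrDl mul1r; lra.
Qed.

End Probability.
End RandomWalk.

(** * Change of measure *)

Section Tilt.
Variables (R : realType) (V : zmodType) (I : finType) (X : I -> V).
Variables (p l : I -> R).
Hypothesis p0 : forall a, 0 <= p a.

(** The Cauchy-Schwarz inequality, with density [l] with respect to [p]. *)
Lemma walk_tilt_sqr_le (g : V -> R) y :
  walk X (fun a => p a * l a) g y ^+ 2 <=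
  (\sum_a p a * l a ^+ 2) * walk X p (fun z => g z ^+ 2) y.
Proof.
rewrite -subr_ge0.
have -> : (\sum_a p a * l a ^+ 2) * walk X p (fun z => g z ^+ 2) y -
    walk X (fun a => p a * l a) g y ^+ 2 =
  2^-1 * \sum_a \sum_b p a * p b * (l a * g (y + X b) - l b * g (y + X a)) ^+ 2.
  have -> : \sum_a \sum_b p a * p b * (l a * g (y + X b) - l b * g (y + X a)) ^+ 2 =
    \sum_a \sum_b (p a * l a ^+ 2) * (p b * g (y + X b) ^+ 2) +
    \sum_a \sum_b (p a * g (y + X a) ^+ 2) * (p b * l b ^+ 2) -
    2 * \sum_a \sum_b (p a * l a * g (y + X a)) * (p b * l b * g (y + X b)).
    rewrite mulr_sumr -sumrN -!big_split /=; apply: eq_bigr => a _.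
    rewrite mulr_sumr -sumrN -!big_split /=; apply: eq_bigr => b _; ring.
  rewrite -!big_distrlr /= /walk; by field.
rewrite mulr_ge0 ?invr_ge0 ?ler0n //.
apply: sumr_ge0 => a _; apply: sumr_ge0 => b _.
by rewrite mulr_ge0 ?sqr_ge0 ?mulr_ge0.
Qed.

Lemma walkn_tilt_sqr_le N (g : V -> R) y :
  iter N (walk X (fun a => p a * l a)) g y ^+ 2 <=
  (\sum_a p a * l a ^+ 2) ^+ N * iter N (walk X p) (fun z => g z ^+ 2) y.
Proof.
set C := \sum_a _.
have C0 : 0 <= C by apply: sumr_ge0 => a _; rewrite mulr_ge0 ?sqr_ge0.
elim: N y => [|N IH] y /=; first by rewrite mul1r.
apply: le_trans (walk_tilt_sqr_le _ _) _.
rewrite -/C exprS -mulrA ler_wpM2l //.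
by have := walk_le X p0 IH y; rewrite walkZ.
Qed.

End Tilt.

(** * The simple random walk in Euclidean space *)

Section SimpleWalk.
Variables (R : realType) (m : nat).
Implicit Types (c q y z : 'rV[R]_m.+1) (g h : 'rV[R]_m.+1 -> R).

Definition step (a : 'I_m.+1 * bool) : 'rV[R]_m.+1 := (-1) ^+ a.2 *: delta_mx 0 a.1.

Definition unif (a : 'I_m.+1 * bool) : R := (2 * m.+1%:R)^-1.

Notation srw := (walk step unif).

Lemma sum_step (f : 'I_m.+1 * bool -> R) :
  \sum_a f a = \sum_i (f (i, false) + f (i, true)).
Proof.
rewrite (eq_bigr (fun a => f (a.1, a.2))); last by case.
rewrite -(pair_bigA _ (fun i b => f (i, b))) /=.
by apply: eq_bigr => i _; rewrite big_bool addrC.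
Qed.

Lemma unif_ge0 a : 0 <= unif a.
Proof. by rewrite invr_ge0 mulr_ge0. Qed.

Lemma dim_neq0 : m.+1%:R != 0 :> R.
Proof. by rewrite pnatr_eq0. Qed.

Lemma unif_sum : \sum_a unif a = 1.
Proof.
rewrite sum_step /unif sumr_const card_ord -[LHS]mulr_natr.
by have := dim_neq0; move: m.+1%:R => d d0; field.
Qed.

Lemma dot_step y a : dot y (step a) = (-1) ^+ a.2 * y 0 a.1.
Proof.
rewrite dotC dotZl; congr *%R; rewrite /dot (bigD1 a.1) //= mxE !eqxx mul1r.
by rewrite big1 ?addr0 // => i /negbTE ia; rewrite mxE ia andbF mul0r.
Qed.

Lemma dot_step1 a : dot (step a) (step a) = 1.
Proof. by rewrite dot_step /step !mxE !eqxx mulr1 -expr2 sqrr_sign. Qed.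

Lemma dotDr n (u v w : 'rV[R]_n) : dot u (v + w) = dot u v + dot u w.
Proof. by rewrite dotC dotDl !(dotC u). Qed.

Lemma dot_sqrD n (u v : 'rV[R]_n) :
  dot (u + v) (u + v) = dot u u + 2 * dot u v + dot v v.
Proof. rewrite dotDl !dotDr (dotC v u); ring. Qed.

Lemma dot_coord_le n (u : 'rV[R]_n) i : u 0 i ^+ 2 <= dot u u.
Proof.
rewrite /dot (bigD1 i) //= -expr2 lerDl; apply: sumr_ge0 => j _.
by rewrite -expr2 sqr_ge0.
Qed.

Lemma sum_unif_dot y : \sum_a unif a * dot y (step a) = 0.
Proof.
rewrite sum_step big1 // => i _; rewrite !dot_step /= /unif; ring.
Qed.

Lemma sum_unif_dot2 y z : \sum_a unif a * (dot y (step a) * dot z (step a)) =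
  dot y z / m.+1%:R.
Proof.
rewrite sum_step /dot mulr_suml; apply: eq_bigr => i _.
rewrite -!/(dot _ _) !dot_step /= /unif.
by have := dim_neq0; move: m.+1%:R => d d0; field.
Qed.

(** The density of a step under a drift [t]: the mean of [step] against
    [unif a * tilt t a] is [t]. *)
Definition tilt (t : 'rV[R]_m.+1) a : R := 1 + m.+1%:R * dot t (step a).

Lemma sum_tilt2 t : \sum_a unif a * tilt t a ^+ 2 = 1 + m.+1%:R * dot t t.
Proof.
have -> : 1 + m.+1%:R * dot t t = \sum_a unif a +
   (2 * m.+1%:R) * \sum_a unif a * dot t (step a) +
   (m.+1%:R ^+ 2) * \sum_a unif a * (dot t (step a) * dot t (step a)).
  rewrite unif_sum sum_unif_dot sum_unif_dot2.
  by have := dim_neq0; move: m.+1%:R => d d0; field.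
rewrite !mulr_sumr -!big_split /=; apply: eq_bigr => a _; rewrite /tilt; ring.
Qed.

Lemma tilt_dist2 t z y :
  walk step (fun a => unif a * tilt t a) (fun x => dot (x - z) (x - z)) y =
  dot (y + t - z) (y + t - z) + 1 - dot t t.
Proof.
set u := y - z.
have -> : y + t - z = u + t by rewrite addrAC.
transitivity (dot u u * (\sum_a unif a) + 2 * (\sum_a unif a * dot u (step a))
  + \sum_a unif a + m.+1%:R * (dot u u + 1) * (\sum_a unif a * dot t (step a)) +
  2 * m.+1%:R * (\sum_a unif a * (dot u (step a) * dot t (step a)))).
  rewrite !mulr_sumr -!big_split /=; apply: eq_bigr => a _.
  have -> : y + step a - z = u + step a by rewrite addrAC.
  by rewrite dot_sqrD dot_step1 /tilt; ring.
rewrite unif_sum !sum_unif_dot sum_unif_dot2 dot_sqrD.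
by have := dim_neq0; move: m.+1%:R => d d0; field.
Qed.

Lemma srw_norm2 N y : iter N srw (fun x => dot x x) y = dot y y + N%:R.
Proof.
elim: N y => [|N IH] y /=; first by rewrite addr0.
have -> : iter N srw (fun x => dot x x) = fun x => dot x x + N%:R by apply/funext.
have := tilt_dist2 0 0 y.
rewrite walkD (walk_cst step unif_sum) -natr1 (addrC N%:R) addrA.
under [X in walk _ _ X _ = _ -> _]eq_fun do rewrite subr0.
have d0 u : dot 0 u = 0 :> R by rewrite dotE mul0mx mxE.
rewrite addr0 !subr0 d0 subr0 => <-; congr (_ + _).
by apply: eq_bigr => a _; rewrite /tilt d0 mulr0 addr0 mulr1.
Qed.

(** Add the drift that carries [c] to [q] in [N] steps. The drifting walk is at
    squared distance at most [N] from [q] in the mean, so by Markov's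
    inequality it ends in the ball with probability at least one half; by
    Cauchy-Schwarz the walk without drift does so with a probability at least
    [1/4] over the second moment of the density, which is bounded by the
    exponential. *)
Lemma srw_ball_ge N c q g : (0 < N)%N ->
    m.+1%:R ^+ 2 * dot (q - c) (q - c) <= N%:R ^+ 2 ->
    (forall y, 0 <= g y) ->
    (forall y, dot (y - q) (y - q) <= 2 * N%:R -> 1 <= g y) ->
  4^-1 <= expR (m.+1%:R * (dot (q - c) (q - c) / N%:R)) * iter N srw g c.
Proof.
move=> N0 qc g0 g1.
have NR : 0 < N%:R :> R by rewrite ltr0n.
pose t := N%:R^-1 *: (q - c); pose w a := unif a * tilt t a.
have tt : dot t t = dot (q - c) (q - c) / N%:R ^+ 2.
  by rewrite /t dotZl dotC dotZl mulrA -invfM -expr2 mulrC.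
(* the drift is small enough for the weights to stay nonnegative *)
have w0 a : 0 <= w a.
  rewrite mulr_ge0 ?unif_ge0 // /tilt.
  suff /lerNnormlW : `|m.+1%:R * dot t (step a)| <= 1 by lra.
  rewrite -(@ler_pXn2r _ 2) ?nnegrE // expr1n real_normK ?num_real // exprMn.
  rewrite dot_step exprMn sqrr_sign mul1r.
  apply: (@le_trans _ _ (m.+1%:R ^+ 2 * dot t t)).
    by rewrite ler_wpM2l ?sqr_ge0 ?dot_coord_le.
  by rewrite tt mulrA ler_pdivrMr ?exprn_gt0 // mul1r.
pose h y : R := (dot (y - q) (y - q) <= 2 * N%:R :> R)%R%:R.
have dist k y : iter k (walk step w) (fun x => dot (x - q) (x - q)) y <=
    dot (y + k%:R *: t - q) (y + k%:R *: t - q) + k%:R.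
  elim: k y => [|k IH] y /=; first by rewrite scale0r !addr0.
  apply: le_trans (walk_le step w0 IH y) _.
  rewrite walkD -[X in X + _]/(walk step w _ y).
  have -> : walk step w (fun=> k%:R) y = k%:R.
    rewrite /walk -mulr_suml; have -> : \sum_a w a = 1.
      have -> : \sum_a w a = \sum_a unif a + m.+1%:R * \sum_a unif a * dot t (step a).
        rewrite mulr_sumr -big_split /=; apply: eq_bigr => a _; rewrite /w /tilt; ring.
      by rewrite unif_sum sum_unif_dot mulr0 addr0.
    by rewrite mul1r.
  rewrite (_ : walk step w _ y = walk step w
     (fun x => dot (x - (q - k%:R *: t)) (x - (q - k%:R *: t))) y); last first.
    by apply: eq_bigr => a _; rewrite opprB !addrA.
  rewrite tilt_dist2 -natr1 scalerDl scale1r.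
  have -> : y + t - (q - k%:R *: t) = y + (k%:R *: t + t) - q.
    by rewrite opprB !addrA [y + t + _]addrAC.
  by have := dot_ge0 t; lra.
(* Markov's inequality: [1 - |y - q|^2 / 2N] is a lower bound for [h] *)
have half : 2^-1 <= iter N (walk step w) h c.
  have hq y : 1 - (2 * N%:R)^-1 * dot (y - q) (y - q) <= h y.
    rewrite /h; case: (leP (dot (y - q) _)) => /= [_|H].
      by rewrite -[leRHS]/(1 : R) gerBl mulr_ge0 ?dot_ge0 ?invr_ge0 ?mulr_ge0.
    by rewrite -[leRHS]/(0 : R) subr_le0 mulrC ler_pdivlMr ?mul1r ?ltW // mulr_gt0.
  apply: le_trans (walkn_le step N w0 hq c).
  have := dist N c; rewrite scalerA divff ?gt_eqF // scale1r (addrC c) subrK subrr.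
  have d0 : dot (0 : 'rV[R]_m.+1) 0 = 0 by rewrite dotE mul0mx mxE.
  rewrite d0 add0r => dN.
  rewrite (_ : iter N (walk step w) _ c = 1 - (2 * N%:R)^-1 *
    iter N (walk step w) (fun y => dot (y - q) (y - q)) c); last first.
    have w1 : \sum_a w a = 1.
      have -> : \sum_a w a = \sum_a unif a + m.+1%:R * \sum_a unif a * dot t (step a).
        rewrite mulr_sumr -big_split /=; apply: eq_bigr => a _; rewrite /w /tilt; ring.
      by rewrite unif_sum sum_unif_dot mulr0 addr0.
    by rewrite walknB walknZ (walkn_cst step w1).
  have : (2 * N%:R)^-1 * N%:R = 2^-1 :> R by field; rewrite gt_eqF.
  have : 0 <= (2 * N%:R)^-1 :> R by rewrite invr_ge0 mulr_ge0.
  by nra.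
have sq : 4^-1 <= iter N (walk step w) h c ^+ 2 by nra.
apply: le_trans sq (le_trans (walkn_tilt_sqr_le step _ unif_ge0 N h c) _).
rewrite sum_tilt2; apply: ler_pM.
- by rewrite exprn_ge0 // addr_ge0 // mulr_ge0 // dot_ge0.
- rewrite -[leLHS](_ : iter N srw (fun=> 0) c = 0); last first.
    by rewrite (walkn_cst step unif_sum).
  by apply: walkn_le; [exact: unif_ge0 | move=> y; exact: sqr_ge0].
- rewrite (_ : m.+1%:R * (dot (q - c) (q - c) / N%:R) = N%:R * (m.+1%:R * dot t t)).
    rewrite expRM_natl lerXn2r ?nnegrE ?expR_ge0 ?expR_ge1Dx //.
    by rewrite ?addr_ge0 // ?mulr_ge0 // dot_ge0.
  by rewrite tt; field; rewrite gt_eqF.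
- apply: walkn_le; [exact: unif_ge0 | move=> y].
  by rewrite /h; case: (leP (dot (y - q) _)) => [/g1|_]; rewrite ?expr1n ?expr0n.
Qed.

(** Both balls are hit with a probability bounded below, and on one of them [g]
    is at distance at least [(mu2 - mu1) / 2] from its mean. *)
Lemma srw_variance_ge N c q1 q2 (D mu1 mu2 : R) g : (0 < N)%N ->
    m.+1%:R ^+ 2 * D <= N%:R ->
    dot (q1 - c) (q1 - c) <= D * N%:R -> dot (q2 - c) (q2 - c) <= D * N%:R ->
    mu1 < mu2 ->
    (forall y, dot (y - q1) (y - q1) <= 2 * N%:R -> g y <= mu1) ->
    (forall y, dot (y - q2) (y - q2) <= 2 * N%:R -> mu2 <= g y) ->
  ((mu2 - mu1) / 2) ^+ 2 / (4 * expR (m.+1%:R * D)) <=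
  iter N srw (fun y => g y ^+ 2) c - iter N srw g c ^+ 2.
Proof.
move=> N0 DN q1c q2c mu12 g1 g2; set M := iter N srw g c.
have NR : 0 < N%:R :> R by rewrite ltr0n.
set dl := (mu2 - mu1) / 2; have dl0 : 0 < dl by rewrite divr_gt0 // subr_gt0.
have -> : iter N srw (fun y => g y ^+ 2) c - M ^+ 2 =
    iter N srw (fun y => (g y - M) ^+ 2) c.
  have -> : (fun y => (g y - M) ^+ 2) =
      (fun y => (g y ^+ 2 - (2 * M) * g y) + M ^+ 2) by apply/funext => y; ring.
  rewrite walknD walknB walknZ (walkn_cst step unif_sum) -/M; ring.
suff key q : dot (q - c) (q - c) <= D * N%:R ->
    (forall y, dot (y - q) (y - q) <= 2 * N%:R -> dl ^+ 2 <= (g y - M) ^+ 2) ->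
    dl ^+ 2 / (4 * expR (m.+1%:R * D)) <= iter N srw (fun y => (g y - M) ^+ 2) c.
  (* the mean [M] is far from one of the two values *)
  have [Mle|Mgt] := leP M ((mu1 + mu2) / 2).
    by apply: (key q2) => // y /g2; rewrite /dl; nra.
  by apply: (key q1) => // y /g1; rewrite /dl; nra.
move=> qc gq; rewrite ler_pdivrMr ?mulr_gt0 ?expR_gt0 //.
have := @srw_ball_ge N c q (fun y => (dl ^+ 2)^-1 * (g y - M) ^+ 2) N0.
rewrite walknZ; move=> /(_ _ _ _)/wrap[].
- apply: (@le_trans _ _ (m.+1%:R ^+ 2 * (D * N%:R))); first by rewrite ler_wpM2l ?sqr_ge0.
  by rewrite mulrA expr2 ler_wpM2r.
- by move=> y; rewrite mulr_ge0 ?sqr_ge0 // invr_ge0 sqr_ge0.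
- by move=> y /gq; rewrite ler_pdivlMl ?exprn_gt0 // mulr1.
set W := iter N srw _ c => H.
have W0 : 0 <= W.
  rewrite -[leLHS](_ : iter N srw (fun=> 0) c = 0); last first.
    by rewrite (walkn_cst step unif_sum).
  by apply: walkn_le; [exact: unif_ge0 | move=> y; exact: sqr_ge0].
have E : expR (m.+1%:R * (dot (q - c) (q - c) / N%:R)) <= expR (m.+1%:R * D).
  by rewrite ler_expR ler_wpM2l // ler_pdivrMr.
have dl2 : 0 < dl ^+ 2 by rewrite exprn_gt0.
have := ler_wpM2r (mulr_ge0 (ltW (etrans (invr_gt0 _) dl2)) W0) E.
move=> /(le_trans H); rewrite mulrCA ler_pdivlMl //; lra.
Qed.

(** Twice the indicator of the ball is at most the difference, in the first
    coordinate direction, of the bounded function that clamps [y_0]; by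
    [smoothing] the averages of a bounded function have small differences. *)
Lemma srw_origin_rare N (K : R) c : 0 <= K ->
  N.+1%:R * iter N srw (fun y => (dot y y <= K ^+ 2)%R%:R) c ^+ 2 <=
  (m.+1%:R * (K + 1)) ^+ 2.
Proof.
move=> K0; pose B := K + 1.
pose clamp (x : R) := Num.max (- B) (Num.min B x).
have B0 : 0 <= B by rewrite /B; lra.
have clamp_sqr x : clamp x ^+ 2 <= B ^+ 2.
  have : - B <= clamp x <= B.
    by rewrite /clamp le_max lexx /= ge_max ge_min lexx andbT; lra.
  by move=> /andP[]; nra.
have clamp_mono x x' : x <= x' -> clamp x <= clamp x'.
  move=> xx'; rewrite /clamp ge_max le_max lexx /= le_max; apply/orP; right.
  by rewrite le_min !ge_min lexx xx' orbT.
have clamp_id x : - B <= x <= B -> clamp x = x.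
  by case/andP=> Bx xB; rewrite /clamp min_r // max_r.
pose g y := clamp (y 0 0).
pose u : 'I_m.+1 * bool := (0, false); pose v : 'I_m.+1 * bool := (0, true).
have stepu y : (y + step u) 0 0 = y 0 0 + 1.
  by rewrite mxE /step !mxE !eqxx expr0 mul1r.
have stepv y : (y + step v) 0 0 = y 0 0 - 1.
  by rewrite mxE /step !mxE !eqxx expr1 mulr1.
have slab y : 2 * (dot y y <= K ^+ 2)%R%:R <= g (y + step u) - g (y + step v).
  rewrite /g stepu stepv; case: (leP (dot y y)) => /= [yK|_].
    have : `|y 0 0| <= K.
      rewrite -(@ler_pXn2r _ 2) ?nnegrE // real_normK ?num_real //.
      exact: le_trans (dot_coord_le _ _) yK.
    rewrite ler_norml => /andP[yK1 yK2].
    by rewrite !clamp_id /B; lra.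
  by rewrite mulr0 subr_ge0 clamp_mono //; lra.
set s := iter N srw _ c.
have s0 : 0 <= s.
  rewrite -[leLHS](_ : iter N srw (fun=> 0) c = 0); last first.
    by rewrite (walkn_cst step unif_sum).
  by apply: walkn_le; [exact: unif_ge0 | move=> y; rewrite ler0n].
have sle : 2 * s <= iter N srw g (c + step u) - iter N srw g (c + step v).
  have := walkn_le step N unif_ge0 slab c.
  by rewrite walknZ walknB !walkn_shift.
have uv : u != v by [].
have := smoothing step unif_ge0 unif_sum N c uv (fun z => clamp_sqr (z 0 0)).
rewrite -/g /unif => H.
have d0 : 0 < m.+1%:R :> R by rewrite ltr0n.
have N0 : 0 < N.+1%:R :> R by rewrite ltr0n.
rewrite exprMn -ler_pdivrMl ?exprn_gt0 // -/B; apply: le_trans H.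
rewrite [leLHS](_ : _ = N.+1%:R * ((2 * m.+1%:R)^-1 * (2 * m.+1%:R)^-1 * (2 * s) ^+ 2)); last first.
  by move: (m.+1%:R) d0 => d d0; field; rewrite gt_eqF.
rewrite !ler_wpM2l ?mulr_ge0 ?invr_ge0 ?mulr_ge0 //.
by rewrite lerXn2r ?nnegrE ?mulr_ge0 // (le_trans _ sle) // mulr_ge0.
Qed.

End SimpleWalk.

(** * Continuously differentiable functions *)

Lemma near_eq_differentiable (R : realType) (V W : normedModType R)
    (f g : V -> W) x :
  (\near x, f x = g x) -> differentiable f x -> differentiable g x.
Proof.
move=> fg df; have fgx : f x = g x by exact: nbhs_singleton fg.
have dE := near_eq_diff df fg.
apply/diff_locallyP; rewrite dE; split; first exact: diff_continuous.
have /diff_locallyP[_ /eqaddoP dfo] := df.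
apply/eqaddoP => e e0.
move: fg; rewrite (near_shift 0) subr0 => fg.
near=> h.
have fgh : f (h + x) = g (h + x) by near: h; exact: fg.
suff : `|(f \o shift x - (cst (f x) + 'd f x)) h| <= e * `|id h|.
  by rewrite !fctE /= fgh fgx.
by near: h; exact: dfo.
Unshelve. all: by end_near. Qed.

Section C1.
Variable R : realType.

(** Continuity is asked of each directional derivative separately: in finite
    dimension this is continuity of the differential, and no topology on
    linear maps is needed. *)
Definition C1_at (p : nat) (g : 'rV[R]_p -> R) (x : 'rV[R]_p) : Prop :=
  (\near x, differentiable g x) /\ forall v, {for x, continuous (fun y => 'd g y v)}.

Section Scalar.
Variable p : nat.
Implicit Types (g h : 'rV[R]_p -> R) (x v : 'rV[R]_p).

Lemma C1_at_differentiable g x : C1_at g x -> differentiable g x.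
Proof. by case=> /nbhs_singleton. Qed.

Lemma C1_at_continuous g x : C1_at g x -> {for x, continuous g}.
Proof. by move/C1_at_differentiable/differentiable_continuous. Qed.

Lemma near_continuous_for (T : topologicalType) (f k : 'rV[R]_p -> T) x :
  (\near x, f x = k x) -> {for x, continuous f} -> {for x, continuous k}.
Proof.
move=> fk cf; rewrite /prop_for /continuous_at -(nbhs_singleton fk).
by apply: cvg_trans (near_eq_cvg fk) cf.
Qed.

Lemma near_C1_at g h x : (\near x, g x = h x) -> C1_at g x -> C1_at h x.
Proof.
move=> gh [dg cg].
have gh' : \forall y \near x, \near y, g y = h y by exact: near_join.
split=> [|v].
  near=> y; apply: (@near_eq_differentiable R _ _ g); near: y; [exact: gh'|exact: dg].
apply: near_continuous_for (cg v).
near=> y; have dgy : differentiable g y by near: y.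
have ghy : \near y, g y = h y by near: y.
by rewrite (near_eq_diff dgy ghy).
Unshelve. all: by end_near. Qed.

Lemma diff_coord i (x v : 'rV[R]_p) : 'd (fun y : 'rV[R]_p => y 0 i : R) x v = v 0 i.
Proof.
have lc : linear (fun y : 'rV[R]_p => y 0 i : R) by move=> a y z; rewrite !mxE.
pose lcM := GRing.isLinear.Build _ _ _ _ _ lc.
pose L : {linear 'rV[R]_p -> R} := HB.pack (fun y : 'rV[R]_p => y 0 i : R) lcM.
by rewrite -[fun y => _]/(L : _ -> _) diff_lin//; exact: coord_continuous.
Qed.

Lemma C1_at_coord i x : C1_at (fun y : 'rV[R]_p => y 0 i) x.
Proof.
split=> [|v]; first by near=> y; exact: differentiable_coord.
apply: (@near_continuous_for _ (cst (v 0 i))); last exact: cst_continuous.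
by near=> y; rewrite diff_coord.
Unshelve. all: by end_near. Qed.

Lemma C1_atM g h x : C1_at g x -> C1_at h x -> C1_at (fun y => g y * h y) x.
Proof.
move=> Cg Ch; have [dg cg] := Cg; have [dh ch] := Ch.
rewrite (_ : (fun y => g y * h y) = g * h); last by apply/funext.
split=> [|v].
  by near=> y; apply: differentiableM; near: y.
apply: (@near_continuous_for _ (fun y => g y * 'd h y v + h y * 'd g y v)).
  near=> y.
  have dgy : differentiable g y by near: y.
  have dhy : differentiable h y by near: y.
  by rewrite diffM.
apply: continuousD; apply: continuousM => //; exact: C1_at_continuous.
Unshelve. all: by end_near. Qed.

Lemma C1_at_sum q (g : 'I_q -> 'rV[R]_p -> R) x :
  (forall k, C1_at (g k) x) -> C1_at (fun y => \sum_k g k y) x.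
Proof.
move=> Cg.
have E : (fun y => \sum_k g k y) = \sum_k g k by apply/funext => y; rewrite fct_sumE.
have dg : \forall y \near x, forall k, differentiable (g k) y.
  exact: (@filter_forall _ _ (fun k y => differentiable (g k) y) (nbhs x) _ (fun k => (Cg k).1)).
split=> [|v].
  near=> y; have dgy : forall k, differentiable (g k) y by near: y.
  by rewrite E; exact: differentiable_sum.
apply: (@near_continuous_for _ (fun y => \sum_k 'd (g k) y v)).
  near=> y; have dgy : forall k, differentiable (g k) y by near: y.
  rewrite E; transitivity ('D_v (\sum_k g k) y); last first.
    by apply: deriveE; exact: differentiable_sum.
  rewrite derive_sum => [|k]; last exact: diff_derivable.
  by apply: eq_bigr => k _; rewrite deriveE.
apply: (@cvg_big _ _ _ _ xpredT add_continuous _ (nbhs x) _ _ _ (nbhs_filter x)) => k _.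
by case: (Cg k) => _; exact.
Unshelve. all: by end_near. Qed.

Lemma C1_at_pos (u u' : R -> R) g x :
    (forall t : R, 0 < t -> is_derive t 1 u (u' t)) -> {for g x, continuous u'} ->
  0 < g x -> C1_at g x -> C1_at (fun y => u (g y)) x.
Proof.
move=> du cu' gx0 Cg; have [dg cg] := Cg.
have gpos : \forall y \near x, 0 < g y.
  by have := C1_at_continuous Cg; move/cvgr_gt; apply.
have du1 y : 0 < g y -> differentiable u (g y).
  by move=> /du[d _]; apply/derivable1_diffP.
split=> [|v].
  near=> y; apply: (@differentiable_comp _ _ _ _ g u); first by near: y.
  by apply: du1; near: y.
apply: (@near_continuous_for _ (fun y => 'd g y v * u' (g y))).
  near=> y; have gy : 0 < g y by near: y.
  have dgy : differentiable g y by near: y.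
  have duy := du1 y gy.
  have /(congr1 (fun L => L v)) /= E := diff_comp dgy duy.
  apply: esym (etrans E _).
  have [d dE] := du _ gy.
  by rewrite diff1E // derive1E dE.
apply: continuousM => //; apply: continuous_comp => //.
exact: C1_at_continuous.
Unshelve. all: by end_near. Qed.

End Scalar.

Lemma C1_at_comp p q (g : 'rV[R]_q -> R) (h : 'rV[R]_p -> 'rV[R]_q) x :
  (forall k, C1_at (fun y => h y 0 k) x) -> C1_at g (h x) ->
  C1_at (fun y => g (h y)) x.
Proof.
move=> Ch Cg; have [dg cg] := Cg.
have hE : h = \sum_k (fun y => h y 0 k *: delta_mx 0 k).
  by apply/funext => y; rewrite fct_sumE [LHS]row_sum_delta.
have dhk : \forall y \near x, forall k, differentiable (fun y => h y 0 k) y.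
  exact: (@filter_forall _ _ (fun k y => differentiable (fun y => h y 0 k) y) (nbhs x) _
    (fun k => (Ch k).1)).
have dh : \forall y \near x, differentiable h y.
  near=> y; rewrite hE; apply: differentiable_sum => k.
  have dhky : forall k, differentiable (fun y => h y 0 k) y by near: y.
  exact: differentiableZl.
have ch : {for x, continuous h}.
  by apply: differentiable_continuous; exact: nbhs_singleton dh.
have dgh : \forall y \near x, differentiable g (h y) by exact: (ch _ dg).
split=> [|v].
  by near=> y; apply: (@differentiable_comp _ _ _ _ h g); near: y.
apply: (@near_continuous_for _ _ (fun y =>
    \sum_k ('d (fun z => h z 0 k) y v * 'd g (h y) (delta_mx 0 k)))).
  near=> y; have dhy : differentiable h y by near: y.
  have dhky : forall k, differentiable (fun y => h y 0 k) y by near: y.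
  have dgy : differentiable g (h y) by near: y.
  have /(congr1 (fun L => L v)) /= E := diff_comp dhy dgy.
  apply: esym (etrans E _).
  have -> : 'd h y v = \sum_k 'd (fun z => h z 0 k) y v *: delta_mx 0 k.
    rewrite -deriveE // {1}hE derive_sum => [|k]; last first.
      by apply: diff_derivable; exact: differentiableZl.
    apply: eq_bigr => k _; rewrite deriveE; last exact: differentiableZl.
    by rewrite diffZl.
  by rewrite linear_sum; apply: eq_bigr => k _; rewrite linearZ.
apply: (@cvg_big _ _ _ _ xpredT add_continuous _ (nbhs x) _ _ _ (nbhs_filter x)) => k _.
have ck := (Ch k).2 v.
have cgk : {for x, continuous (fun y => 'd g (h y) (delta_mx 0 k))}.
  exact: (@continuous_comp _ _ _ h (fun z => 'd g z (delta_mx 0 k))).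
exact: (continuousM ck cgk).
Unshelve. all: by end_near. Qed.

End C1.

(** The mean value theorem on the segment from [u] to [u + t v]. The estimate
    is uniform in the base point [u], as the compactness argument of
    [energy_far] requires. *)
Lemma near_increment (R : realType) p (g d : 'rV[R]_p -> R) (x v : 'rV[R]_p)
    (eta : R) :
    (\forall y \near x, is_derive y v g (d y)) -> {for x, continuous d} -> 0 < eta ->
  \forall u \near x & t \near 0^'+, `|g (u + t *: v) - g u - t * d x| <= eta * t.
Proof.
move=> dg cd eta0.
have Px : \forall y \near x, is_derive y v g (d y) /\ `|d x - d y| <= eta.
  by apply: filterI => //; move: cd => /cvgr_dist_le; exact.
have : \forall z \near (x, 0 : R),
    is_derive (z.1 + z.2 *: v) v g (d (z.1 + z.2 *: v)) /\
    `|d x - d (z.1 + z.2 *: v)| <= eta.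
  have cs : {for (x, 0 : R), continuous (fun z : 'rV[R]_p * R => z.1 + z.2 *: v)}.
    apply: cvgD; first exact: cvg_fst.
    by apply: cvgZr_tmp; exact: cvg_snd.
  have xE : x = x + 0 *: v by rewrite scale0r addr0.
  by rewrite {1}xE in Px; exact: (cs _ Px).
case=> -[A B] /= [Ax /nbhs_ballP[e /= e0 Be]] AB.
exists (A, [set t | 0 < t < e]) => /=.
  split => //; near=> t; apply/andP; split; near: t.
    exact: nbhs_right_gt.
  exact: nbhs_right_lt.
case=> u t /= [Au /andP[t0 te]].
have Bs (s : R) : 0 <= s <= t -> B s.
  move=> /andP[s0 st]; apply: Be; rewrite /ball /= sub0r normrN ger0_norm //.
  exact: le_lt_trans te.
have line (s : R) : 0 <= s <= t ->
    is_derive s 1 (fun s => g (u + s *: v)) (d (u + s *: v)).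
  move=> /Bs Bs'; have [/= [dgs dgE] _] := AB (u, s) (conj Au Bs').
  have E : (fun h => h^-1 *: (((fun s => g (u + s *: v)) \o shift s) (h *: (1 : R)) -
      g (u + s *: v))) =
      (fun h => h^-1 *: ((g \o shift (u + s *: v)) (h *: v) - g (u + s *: v))).
    apply/funext => h /=; congr (_ *: (g _ - _)).
    by rewrite -[h *: 1]/(h * 1) mulr1 scalerDl addrCA.
  by apply: DeriveDef; [rewrite /derivable E|rewrite /derive E].
have [||c cin] := @MVT_segment R (fun s => g (u + s *: v))
   (fun s => d (u + s *: v)) 0 t (ltW t0).
- by move=> s; rewrite in_itv /= => /andP[s0 st]; apply: line; rewrite !ltW.
- apply: derivable_within_continuous => s; rewrite in_itv /= => st.
  by have [] := line _ st.
rewrite scale0r addr0 subr0 => ->.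
rewrite in_itv /= in cin.
have [_ /= H] := AB (u, c) (conj Au (Bs _ cin)).
by rewrite [t * _]mulrC -mulrBl normrM (gtr0_norm t0) ler_wpM2r ?(ltW t0) // distrC.
Unshelve. all: by end_near. Qed.

Lemma C1_at_increment (R : realType) p (g : 'rV[R]_p -> R) (x v : 'rV[R]_p)
    (eta : R) : C1_at g x -> 0 < eta ->
  \forall u \near x & t \near 0^'+,
    `|g (u + t *: v) - g u - t * 'd g x v| <= eta * t.
Proof.
move=> [dg cg] eta0; apply: (@near_increment _ _ g (fun y => 'd g y v)) => //.
near=> y; have dgy : differentiable g y by near: y.
by apply: DeriveDef; [exact: diff_derivable|exact: deriveE].
Unshelve. all: by end_near. Qed.

Lemma diff_coord_comp (R : realType) p q (h : 'rV[R]_p -> 'rV[R]_q) x v j :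
  differentiable h x -> 'd (fun y => h y 0 j) x v = ('d h x v) 0 j.
Proof.
move=> dh; pose c := fun z : 'rV[R]_q => z 0 j : R.
have dc : differentiable c (h x) by exact: differentiable_coord.
have E := congr1 (fun L => L v) (diff_comp dh dc).
exact: (etrans E (diff_coord _ _ _)).
Qed.

(** * The extension of degree one of a map of spheres *)

Section RadialExtension.
Variables (R : realType) (m n : nat).
Implicit Types (F : 'rV[R]_m.+1 -> 'rV[R]_n.+1) (x y u v : 'rV[R]_m.+1).

(** Degree one makes the extension norm preserving, with a derivative that is
    bounded near the origin, in contrast to [F \o radial_proj]. *)
Definition hext F y : 'rV[R]_n.+1 := Num.sqrt (dot y y) *: F (radial_proj y).

Lemma dot_scale2 p (a : R) (u : 'rV[R]_p) : dot (a *: u) (a *: u) = a ^+ 2 * dot u u.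
Proof. by rewrite dotZl dotC dotZl mulrA. Qed.

Lemma dot_gt0 p (u : 'rV[R]_p) : (0 < dot u u) = (u != 0).
Proof.
rewrite lt_def dot_ge0 andbT; congr (~~ _); apply/eqP/eqP => [/dot_eq0 //|->].
by rewrite dotE mul0mx mxE.
Qed.

Lemma radial_projK x : unit_sphere R m x -> radial_proj x = x.
Proof. by move=> x1; rewrite /radial_proj x1 sqrtr1 invr1 scale1r. Qed.

Lemma radial_proj_sphere y : y != 0 -> unit_sphere R m (radial_proj y).
Proof.
rewrite -dot_gt0 => y0; rewrite /unit_sphere /= /radial_proj dot_scale2 exprVn.
by rewrite sqr_sqrtr ?ltW // mulVf // gt_eqF.
Qed.

Lemma radial_projZ (a : R) y : 0 < a -> radial_proj (a *: y) = radial_proj y.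
Proof.
move=> a0; rewrite /radial_proj dot_scale2 sqrtrM ?sqr_ge0 // sqrtr_sqr.
by rewrite gtr0_norm // scalerA invfM mulrAC mulVf ?gt_eqF // mul1r.
Qed.

Lemma hext_sphere F x : unit_sphere R m x -> hext F x = F x.
Proof. by move=> x1; rewrite /hext radial_projK // x1 sqrtr1 scale1r. Qed.

Lemma hextZ F (a : R) y : 0 <= a -> hext F (a *: y) = a *: hext F y.
Proof.
rewrite le_eqVlt => /orP[/eqP <-|a0].
  by rewrite !scale0r /hext dotE mul0mx mxE sqrtr0 scale0r.
rewrite /hext radial_projZ // dot_scale2 sqrtrM ?sqr_ge0 // sqrtr_sqr gtr0_norm //.
by rewrite scalerA.
Qed.

Lemma hext_norm F y : set_fun (unit_sphere R m) (unit_sphere R n) F ->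
  dot (hext F y) (hext F y) = dot y y.
Proof.
move=> SF; have [->|y0] := eqVneq y 0.
  by rewrite /hext [dot 0 0]dotE mul0mx mxE sqrtr0 scale0r dotE mul0mx mxE.
have := SF _ (radial_proj_sphere y0); rewrite /unit_sphere /= => F1.
by rewrite /hext dot_scale2 F1 mulr1 sqr_sqrtr // dot_ge0.
Qed.

Lemma C1_at_dot x : C1_at (fun y : 'rV[R]_m.+1 => dot y y) x.
Proof. by apply: C1_at_sum => i; apply: C1_atM; exact: C1_at_coord. Qed.

Lemma C1_at_norm x : 0 < dot x x ->
  C1_at (fun y : 'rV[R]_m.+1 => Num.sqrt (dot y y)) x.
Proof.
move=> x0; apply: (@C1_at_pos _ _ Num.sqrt (fun t => (2 * Num.sqrt t)^-1)
  (fun y => dot y y)) => //; last exact: C1_at_dot.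
apply: continuousV; first by rewrite mulf_neq0 // gt_eqF ?sqrtr_gt0.
apply: continuousM; first exact: cst_continuous.
exact: sqrt_continuous.
Qed.

Lemma C1_at_invnorm x : 0 < dot x x ->
  C1_at (fun y : 'rV[R]_m.+1 => (Num.sqrt (dot y y))^-1) x.
Proof.
move=> x0; apply: (@C1_at_pos _ _ (fun t => t^-1) (fun t => - (t ^+ 2)^-1)
  (fun y => Num.sqrt (dot y y))).
- move=> t t0; have tn0 : t != 0 by rewrite gt_eqF.
  have := @is_deriveV R id t 1 1 tn0 (is_derive_id t 1).
  by rewrite -[X in is_derive _ _ _ X -> _]/(- t ^- 2 * 1) mulr1.
- apply: continuousN; apply: continuousV.
    by rewrite expf_neq0 // gt_eqF ?sqrtr_gt0.
  exact: exprn_continuous.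
- by rewrite sqrtr_gt0.
- exact: C1_at_norm.
Qed.

Lemma C1_at_hext F x j : smooth_sphere_map F -> unit_sphere R m x ->
  C1_at (fun y => hext F y 0 j) x.
Proof.
move=> [SF lF] x1; have [U [f [oU Ux smf fF]]] := lF x x1.
have x0 : 0 < dot x x by rewrite x1.
have Crad k : C1_at (fun y : 'rV[R]_m.+1 => radial_proj y 0 k) x.
  have -> : (fun y : 'rV[R]_m.+1 => radial_proj y 0 k) =
      (fun y => (Num.sqrt (dot y y))^-1 * y 0 k).
    by apply/funext => y; rewrite mxE.
  by apply: C1_atM; [exact: C1_at_invnorm | exact: C1_at_coord].
have [df cf] := smf 1%N.
have UV y : U y -> nbhs y U by move=> Uy; exact: open_nbhs_nbhs.
have Cf : C1_at (fun y => f y 0 j) x.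
  have dfj y : U y -> differentiable (fun y => f y 0 j) y.
    move=> Uy; apply: (@differentiable_comp _ _ _ _ f (fun z => z 0 j : R)).
      exact: df.
    exact: differentiable_coord.
  split; first by near=> y; apply: dfj; near: y; exact: UV.
  move=> v; apply: (@near_continuous_for _ _ _ (fun y => ('D_v f y) 0 j)).
    near=> y; have Uy : U y by near: y; exact: UV.
    have dfy : differentiable f y by exact: df.
    by rewrite (deriveE v dfy) diff_coord_comp.
  have cc : {for 'D_v f x, continuous (fun z : 'rV[R]_n.+1 => z 0 j : R)}.
    exact: coord_continuous.
  exact: (@continuous_comp _ _ _ ('D_v f) (fun z => z 0 j : R) x (cf v x Ux) cc).
apply: (@near_C1_at _ _ (fun y => Num.sqrt (dot y y) * f (radial_proj y) 0 j)).
  have cr : {for x, continuous (@radial_proj R m)}.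
    have t0 : tangent x 0 by rewrite /tangent /= dotE mul0mx mxE.
    have [dr _] := radial_proj_diff x1 t0.
    exact: differentiable_continuous.
  have Ur : \forall y \near x, U (radial_proj y).
    by apply: cr; rewrite radial_projK //; exact: UV.
  have pos : \forall y \near x, 0 < dot y y.
    by have := C1_at_continuous (C1_at_dot x); move/cvgr_gt; apply.
  near=> y; rewrite mxE fF //; first by near: y.
  by apply: radial_proj_sphere; rewrite -dot_gt0; near: y.
apply: C1_atM; first exact: C1_at_norm.
have Cf' : C1_at (fun y => f y 0 j) (radial_proj x) by rewrite radial_projK.
exact: (C1_at_comp Crad Cf').
Unshelve. all: by end_near. Qed.

Lemma differentiable_hext F x : smooth_sphere_map F -> unit_sphere R m x ->
  differentiable (hext F) x.
Proof.
move=> sF x1.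
have -> : hext F = \sum_k (fun y => hext F y 0 k *: delta_mx 0 k).
  by apply/funext => y; rewrite fct_sumE [LHS]row_sum_delta.
apply: differentiable_sum => k; apply: differentiableZl.
exact: C1_at_differentiable (C1_at_hext k sF x1).
Qed.

Lemma diff_hext_coord F x v j : smooth_sphere_map F -> unit_sphere R m x ->
  ('d (hext F) x v) 0 j = 'd (fun y => hext F y 0 j) x v.
Proof.
move=> sF x1; have dF := differentiable_hext sF x1.
by rewrite diff_coord_comp.
Qed.

(** Euler's relation, read off from [hext F (x + t x) = (1 + t) hext F x]. *)
Lemma diff_hext_radial F x j : smooth_sphere_map F -> unit_sphere R m x ->
  'd (fun y => hext F y 0 j) x x = hext F x 0 j.
Proof.
move=> sF x1; apply/eqP; rewrite -subr_eq0 -normr_le0.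
apply/ler_addgt0Pr => e e0; rewrite add0r.
suff key (b : R) : (\forall u \near x & t \near 0^'+,
    `|hext F (u + t *: x) 0 j - hext F u 0 j - t * b| <= e * t) ->
    `|b - hext F x 0 j| <= e.
  exact: key (C1_at_increment x (C1_at_hext j sF x1) e0).
case=> -[A B] /= [Ax B0] AB.
have H : \forall t \near 0^'+, 0 < t :> R /\ B t.
  by apply: filterI => //; exact: nbhs_right_gt.
have [t [t0 Bt]] := @filter_ex _ _ (at_right_proper_filter (0 : R)) _ H.
have /= := AB (x, t) (conj (nbhs_singleton Ax) Bt).
have -> : x + t *: x = (1 + t) *: x by rewrite scalerDl scale1r.
rewrite hextZ; last by rewrite addr_ge0 // ltW.
rewrite mxE => Ht; rewrite -(ler_pM2r t0); apply: le_trans Ht.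
rewrite -[X in _ * X](gtr0_norm t0) -normrM -normrN le_eqVlt; apply/orP; left.
by apply/eqP; congr `|_|; ring.
Qed.

(** The trace of the Gram matrix of the derivative is computed in an
    orthonormal basis adapted to the sphere: the radial direction contributes
    [1], and on tangent vectors the derivative of the extension is that
    of [F]. *)
Lemma diff_hext_sqr F x : smooth_sphere_map F -> unit_sphere R m x ->
  \sum_i \sum_j 'd (fun y => hext F y 0 j) x (delta_mx 0 i) ^+ 2 =
  1 + sq_norm_diff F x.
Proof.
move=> sF x1; have dF := differentiable_hext sF x1.
have [_ [_ [E [fE _]]]] := singular_values_exist F x1.
rewrite (sq_norm_diffE F x1 fE); set J := lin1_mx ('d (hext F) x).
have mulJ u : u *m J = 'd (hext F) x u by rewrite mul_rV_lin1.
have dotJ u w : dot (u *m (J *m J^T)) w = dot ('d (hext F) x u) ('d (hext F) x w).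
  by rewrite -!mulJ !dotE trmx_mul !mulmxA.
have := frame_trace (J *m J^T) x1 fE.
rewrite dotJ.
have -> : 'd (hext F) x x = F x.
  by apply/rowP => j; rewrite diff_hext_coord // diff_hext_radial // hext_sphere.
have /= -> := sF.1 x x1.
move=> tr; rewrite addrC; apply/eqP; rewrite -subr_eq; apply/eqP.
transitivity (\tr (J *m J^T) - 1).
  congr (_ - 1); rewrite /mxtrace; apply: eq_bigr => i _.
  rewrite mxE; apply: eq_bigr => j _.
  have JE : J i j = 'd (fun y => hext F y 0 j) x (delta_mx 0 i).
    by rewrite -diff_hext_coord // mxE.
  by rewrite [J^T _ _]mxE !JE expr2.
rewrite -tr; apply: eq_bigr => i _; rewrite dotJ.
have [Et _] := fE.
by rewrite (@sphere_diffE R m n F (hext F) setT x) //;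
  [exact: openT|move=> y _; exact: hext_sphere].
Qed.

End RadialExtension.

(** * Averages of homogeneous functions *)

Lemma unit_sphere_compact (R : realType) m : compact (unit_sphere R m).
Proof.
apply: bounded_closed_compact.
  exists 1; split => // M M1 v v1; rewrite /= [leLHS]/Num.norm /= mx_normrE.
  apply/bigmax_leP; split => [|[i j] _ /=]; first by rewrite ltW // (lt_trans _ M1).
  rewrite (le_trans _ (ltW M1)) // ord1 -(@ler_pXn2r _ 2) ?nnegrE //.
  rewrite expr1n -normrX ger0_norm ?sqr_ge0 //; apply: le_trans (dot_coord_le v j) _.
  by rewrite v1.
rewrite (_ : unit_sphere R m = (fun v : 'rV[R]_m.+1 => dot v v) @^-1` [set 1]) //.
apply: preimage_closed; last exact: closed_eq.
by move=> v _; apply: C1_at_continuous; exact: C1_at_dot.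
Qed.

Section Energy.
Variables (R : realType) (m : nat) (J : finType).
Variables (f : J -> 'rV[R]_m.+1 -> R) (df : 'I_m.+1 * bool -> J -> 'rV[R]_m.+1 -> R).
Implicit Types (c x y z : 'rV[R]_m.+1).

Notation step := (@step R m).
Notation unif := (@unif R m).
Notation srwn N := (iter N (walk step unif)).
Notation sphere := (unit_sphere R m).
Notation d := (m.+1%:R : R).

(** [f] stands for the components of a norm preserving map that is homogeneous
    of degree one, and [df a j x] for the derivative of [f j] at the point [x]
    of the sphere in the direction [step a]. Of differentiability only the
    uniform estimate [df_near] is retained. *)
Hypothesis f_norm : forall y, \sum_j f j y ^+ 2 = dot y y.
Hypothesis fZ : forall j (r : R) y, 0 <= r -> f j (r *: y) = r * f j y.
Hypothesis df_near : forall x a j (eta : R), sphere x -> 0 < eta ->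
  \forall u \near x & t \near 0^'+,
    `|f j (u + t *: step a) - f j u - t * df a j x| <= eta * t.

Definition energy y : R := \sum_j carre step unif (f j) y.

Lemma energyE y :
  energy y = (2 * d)^-1 * \sum_a \sum_j (f j (y + step a) - f j y) ^+ 2.
Proof.
rewrite /energy exchange_big mulr_sumr /=; apply: eq_bigr => a _.
by rewrite mulr_sumr.
Qed.

Lemma energy_scaled (t : R) u : 0 < t ->
  t ^+ 2 * energy (t^-1 *: u) =
  (2 * d)^-1 * \sum_a \sum_j (f j (u + t *: step a) - f j u) ^+ 2.
Proof.
move=> t0; rewrite energyE mulrCA; congr (_ * _).
rewrite mulr_sumr; apply: eq_bigr => a _; rewrite mulr_sumr.
apply: eq_bigr => j _; rewrite -exprMn; congr (_ ^+ 2).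
by rewrite mulrBr -!fZ ?ltW // scalerDr scalerA divff ?gt_eqF // scale1r.
Qed.

Section Bounds.
(** The bound [|Df|^2 <= d], each coordinate direction being counted with both
    signs. *)
Hypothesis df_energy : forall x, sphere x -> \sum_a \sum_j df a j x ^+ 2 <= 2 * d.

Lemma energy_near x (eps : R) : sphere x -> 0 < eps ->
  \forall u \near x & t \near 0^'+,
    \sum_a \sum_j (f j (u + t *: step a) - f j u) ^+ 2 <= t ^+ 2 * (2 * d * (1 + eps)).
Proof.
move=> x1 eps0; pose k : R := #|J|%:R.
(* [(|b| + eta)^2 <= (1 + eta) b^2 + 2 eta] for [eta <= 1], summed over the
   [2 d k] pairs of a direction and a component *)
pose eta := Num.min 1 (eps / (1 + 2 * k)).
have k0 : 0 <= k by rewrite ler0n.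
have eta0 : 0 < eta by rewrite lt_min ltr01 divr_gt0 //; lra.
have eta1 : eta <= 1 by rewrite ge_min lexx.
have etaeps : eta * (1 + 2 * k) <= eps.
  by rewrite -ler_pdivlMr ?ge_min ?lexx ?orbT //; lra.
pose P a j (z : 'rV[R]_m.+1 * R) :=
  `|f j (z.1 + z.2 *: step a) - f j z.1 - z.2 * df a j x| <= eta * z.2.
have H1 : \forall z \near filter_prod (nbhs x) (0^'+), forall a j, P a j z.
  have H0 a j : \forall z \near filter_prod (nbhs x) (0^'+), P a j z by exact: df_near.
  have H00 a : \forall z \near filter_prod (nbhs x) (0^'+), forall j, P a j z.
    exact: (@filter_forall _ _ (P a) _ _ (H0 a)).
  exact: (@filter_forall _ ('I_m.+1 * bool)%type
    (fun a (z : 'rV[R]_m.+1 * R) => forall j, P a j z) _ _ H00).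
have H2 : \forall z \near filter_prod (nbhs x) (0^'+), 0 < z.2 :> R.
  exists (setT, [set t | 0 < t]) => /=; last by move=> z [].
  by split; [exact: filterT|exact: nbhs_right_gt].
suff : \forall z \near filter_prod (nbhs x) (0^'+),
    \sum_a \sum_j (f j (z.1 + z.2 *: step a) - f j z.1) ^+ 2 <=
    z.2 ^+ 2 * (2 * d * (1 + eps)) by [].
apply: filterS2 H1 H2 => -[u t] /= H t0.
apply: (@le_trans _ _ (t ^+ 2 * (\sum_a \sum_j
    ((1 + eta) * df a j x ^+ 2 + 2 * eta)))).
  rewrite mulr_sumr; apply: ler_sum => a _; rewrite mulr_sumr.
  apply: ler_sum => j _; have := H a j; rewrite /P /=.
  move: (f j _ - f j _) (df a j x) => w b; rewrite ler_norml => /andP[w1 w2].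
  have tb : w ^+ 2 <= t ^+ 2 * (`|b| + eta) ^+ 2.
    rewrite -exprMn -[leLHS]real_normK ?num_real // lerXn2r ?nnegrE //.
      by rewrite mulr_ge0 ?addr_ge0 // ltW.
    rewrite ler_norml mulrDr.
    have : t * `|b| = `|t * b| by rewrite normrM (gtr0_norm t0).
    have := ler_norm (t * b); have := lerNnormlW (lexx `|t * b|).
    by move=> ? ? ->; apply/andP; split; lra.
  apply: le_trans tb _; rewrite ler_wpM2l ?sqr_ge0 //.
  have -> : b ^+ 2 = `|b| ^+ 2 by rewrite real_normK ?num_real.
  have := sqr_ge0 (`|b| - 1); have := normr_ge0 b; nra.
rewrite ler_wpM2l ?sqr_ge0 //.
under eq_bigr do rewrite big_split /= -mulr_sumr sumr_const.
rewrite big_split /= -mulr_sumr sumr_const card_prod card_ord card_bool.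
rewrite -mulrnA -[2 * eta *+ _]mulr_natr !natrM -/k.
have := df_energy x1; have d0 : 0 < d by rewrite ltr0n.
move: (d) (\sum_a _) d0 => d' S d0 Sd.
have : (1 + eta) * S <= (1 + eta) * (2 * d') by rewrite ler_wpM2l // addr_ge0 // ltW.
have : (2 * d') * (eta * (1 + 2 * k)) <= (2 * d') * eps by rewrite ler_wpM2l // mulr_ge0 // ltW.
by lra.
Qed.

(** Unit increments at [y] are, by homogeneity, increments of size [1 / |y|] at
    a point of the sphere, where compactness makes [energy_near] uniform. *)
Lemma energy_far (eps : R) : 0 < eps ->
  exists2 K : R, 0 < K & forall y, K ^+ 2 < dot y y -> energy y <= 1 + eps.
Proof.
move=> eps0.
have /compact_near_coveringP cS := @unit_sphere_compact R m.
pose P (t : R) u := \sum_a \sum_j (f j (u + t *: step a) - f j u) ^+ 2 <=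
    t ^+ 2 * (2 * d * (1 + eps)).
have : \forall t \near 0^'+, sphere `<=` P t.
  by apply: cS => x x1; exact: energy_near.
case/nbhs_ballP => e /= e0 He.
exists (2 / e); first by rewrite divr_gt0.
move=> y Ky; pose r := Num.sqrt (dot y y).
have y0 : 0 < dot y y by apply: le_lt_trans Ky; rewrite sqr_ge0.
have r0 : 0 < r by rewrite sqrtr_gt0.
have Kr : 2 / e < r.
  rewrite -(@ltr_pXn2r _ 2) ?nnegrE ?divr_ge0 ?(ltW e0) ?(ltW r0) //.
  by rewrite sqr_sqrtr // ltW.
have re : ball (0 : R) e r^-1.
  rewrite /ball /= sub0r normrN gtr0_norm ?invr_gt0 // invf_plt ?posrE //.
  by apply: lt_trans Kr; rewrite ltr_pdivlMr // mulVf ?gt_eqF //; lra.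
have ri : 0 < r^-1 by rewrite invr_gt0.
have yE : y = r^-1^-1 *: radial_proj y.
  by rewrite invrK /radial_proj scalerA -/r divff ?gt_eqF // scale1r.
have yn0 : y != 0 by rewrite -dot_gt0.
have := He _ re ri _ (radial_proj_sphere yn0).
rewrite /P -(ler_pM2l (_ : 0 < (2 * d)^-1)) ?invr_gt0 ?mulr_gt0 ?ltr0n //.
rewrite -energy_scaled // -yE mulrCA ler_pM2l ?exprn_gt0 //.
by rewrite mulrA mulVf ?mul1r // mulf_neq0 // pnatr_eq0.
Qed.

Lemma energy_le y : energy y <= 4 * dot y y + 2.
Proof.
have unif0 a : 0 <= unif a by exact: unif_ge0.
rewrite /energy.
apply: (@le_trans _ _ (\sum_j \sum_a unif a * (2 * f j (y + step a) ^+ 2 + 2 * f j y ^+ 2))).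
  apply: ler_sum => j _; apply: ler_sum => a _; rewrite ler_wpM2l //.
  by rewrite /diffop; have := sqr_ge0 (f j (y + step a) + f j y); nra.
rewrite exchange_big /=.
under eq_bigr do rewrite -mulr_sumr big_split /= -!mulr_sumr !f_norm.
have := srw_norm2 1 y; rewrite /= /walk => N1.
have U1 : \sum_a unif a = 1 by exact: unif_sum.
rewrite (_ : \sum_a _ = 2 * (\sum_a unif a * dot (y + step a) (y + step a)) +
    2 * dot y y * \sum_a unif a); first by rewrite N1 U1; lra.
by rewrite !mulr_sumr -big_split; apply: eq_bigr => a _ /=; ring.
Qed.

(** Far from the origin [energy_far] applies; near the origin the energy is
    merely bounded, but the walk is there with vanishing probability, uniformly
    in its starting point. *)
Lemma srw_energy_le (eps : R) : 0 < eps ->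
  exists N0, forall N, (N0 <= N)%N -> forall c, srwn N energy c <= 1 + eps.
Proof.
move=> eps0; have e20 : 0 < eps / 2 by rewrite divr_gt0.
have [K K0 HK] := energy_far e20.
pose C := 4 * K ^+ 2 + 2; have C0 : 0 < C by rewrite ltr_wpDl // mulr_ge0 // sqr_ge0.
pose B := (d * (K + 1) * (2 * C / eps)) ^+ 2.
exists (Num.bound B) => N N0N c.
have BN : B <= N.+1%:R.
  have : B < (Num.bound B)%:R.
    by have := archi_boundP (sqr_ge0 _ : 0 <= B).
  move=> /ltW /le_trans; apply; rewrite ler_nat; exact: leqW.
pose ind y : R := (dot y y <= K ^+ 2)%R%:R.
have le1 y : energy y <= (1 + eps / 2) + C * ind y.
  rewrite /ind; case: (leP (dot y y)) => yK /=.
    rewrite mulr1; apply: le_trans (energy_le y) _; rewrite /C.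
    by lra.
  by rewrite mulr0 addr0; exact: HK.
apply: le_trans (walkn_le step N (@unif_ge0 R m) le1 c) _.
rewrite walknD walknZ (walkn_cst step (@unif_sum R m)).
have := srw_origin_rare N c (ltW K0); rewrite -/ind; set s := iter N _ _ c => Ns.
suff : C * s <= eps / 2 by lra.
rewrite leNgt; apply/negP => sC.
have sgt : eps / (2 * C) < s by rewrite ltr_pdivrMr ?mulr_gt0 //; lra.
have s0 : 0 < eps / (2 * C) by rewrite divr_gt0 // mulr_gt0.
have : N.+1%:R * (eps / (2 * C)) ^+ 2 < (d * (K + 1)) ^+ 2.
  apply: lt_le_trans Ns; rewrite ltr_pM2l ?ltr0n //.
  by rewrite ltr_pXn2r // nnegrE ltW // (lt_trans s0).
rewrite ltNge => /negP; apply.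
have -> : (d * (K + 1)) ^+ 2 = B * (eps / (2 * C)) ^+ 2.
  rewrite /B -exprMn; congr (_ ^+ 2); field; rewrite !gt_eqF //.
by rewrite ler_wpM2r ?sqr_ge0.
Qed.

(** The ball around [rho sqrt N x] lies in a narrow cone around [x] once [rho] is
    large, and far from the origin once [N] is large; there the increment is
    close to the derivative at [x]. *)
Lemma diffop_far x a j (eta : R) : sphere x -> 0 < eta ->
  exists2 rho0 : R, 0 < rho0 & forall rho, rho0 <= rho -> exists N0,
    forall N, (N0 <= N)%N -> forall y,
      dot (y - (rho * Num.sqrt N%:R) *: x) (y - (rho * Num.sqrt N%:R) *: x) <=
        2 * N%:R ->
      `|diffop step a (f j) y - df a j x| <= eta.
Proof.
move=> x1 eta0; have [[A B] /= [Ax B0] AB] := df_near a j x1 eta0.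
have /nbhs_ballP[dl /= dl0 Adl] := Ax.
have /nbhs_ballP[e /= e0 Be] := B0.
exists (2 / dl) => [|rho rho_ge]; first by rewrite divr_gt0.
have rho0 : 0 < rho by apply: lt_le_trans rho_ge; rewrite divr_gt0.
exists (Num.bound ((rho * e) ^- 2)).+1 => N N0N y.
set s := Num.sqrt N%:R; set r := rho * s; set u := y - r *: x => yN.
have NR : 0 < N%:R :> R by rewrite ltr0n (leq_trans _ N0N).
have s0 : 0 < s by rewrite sqrtr_gt0.
have ss : s ^+ 2 = N%:R by rewrite sqr_sqrtr // ltW.
have r0 : 0 < r by rewrite mulr_gt0.
have ri : 0 < r^-1 by rewrite invr_gt0.
have Br : B r^-1.
  apply: Be => //; rewrite /ball /= sub0r normrN gtr0_norm // invf_plt ?posrE //.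
  rewrite -(@ltr_pXn2r _ 2) ?nnegrE ?invr_ge0 ?(ltW e0) ?(ltW r0) // exprVn.
  rewrite /r exprMn ss -ltr_pdivrMl ?exprn_gt0 // -invfM -exprMn.
  apply: lt_le_trans (_ : (Num.bound ((rho * e) ^- 2))%:R <= _).
    by apply: archi_boundP; rewrite invr_ge0 sqr_ge0.
  by rewrite ler_nat ltnW.
have Ar : A (r^-1 *: y).
  apply: Adl; split=> // i k; rewrite ord1 /ball /= -(@ltr_pXn2r _ 2) ?nnegrE ?(ltW dl0) //.
  rewrite real_normK ?num_real //.
  have -> : x 0 k - (r^-1 *: y) 0 k = - (r^-1 *: u) 0 k.
    by rewrite /u !mxE; field; rewrite gt_eqF.
  rewrite sqrrN; apply: le_lt_trans (dot_coord_le _ k) _.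
  rewrite dot_scale2; apply: (@le_lt_trans _ _ (r^-1 ^+ 2 * (2 * N%:R))).
    by rewrite ler_wpM2l ?sqr_ge0.
  rewrite exprVn ltr_pdivrMl ?exprn_gt0 // /r exprMn ss mulrAC ltr_pM2r //.
  apply: (@lt_le_trans _ _ ((2 / dl) ^+ 2 * dl ^+ 2)).
    by rewrite -exprMn divfK ?gt_eqF //; lra.
  rewrite ler_wpM2r ?sqr_ge0 // lerXn2r ?nnegrE //; last exact: ltW.
  by rewrite divr_ge0 // ltW.
have /= := AB (r^-1 *: y, r^-1) (conj Ar Br).
have ri' := ltW ri.
rewrite -scalerDr !fZ // -mulrBr -mulrBr normrM gtr0_norm //.
by rewrite mulrC ler_pM2r.
Qed.

(** The difference is a sum of variances of increments under the walk. The
    increment of [f j] along [step a] is close to [df a j p] on a ball around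
    [rho sqrt N p] and close to [df a j q] on a ball around [rho sqrt N q], and
    [srw_variance_ge] applies. *)
Lemma srw_energy_gap p q a j : sphere p -> sphere q -> df a j p < df a j q ->
  exists2 kap : R, 0 < kap & exists N0, forall N, (N0 <= N)%N ->
    forall c, dot c c <= N.+1%:R ->
    kap <= srwn N energy c - \sum_j carre step unif (srwn N (f j)) c.
Proof.
move=> p1 q1 pq; pose eta := (df a j q - df a j p) / 3.
have eta0 : 0 < eta by rewrite divr_gt0 // subr_gt0.
have [rp rp0 Hp] := diffop_far a j p1 eta0.
have [rq rq0 Hq] := diffop_far a j q1 eta0.
pose rho := Num.max rp rq.
have [Np HNp] : exists N0, forall N, (N0 <= N)%N -> forall y,
    dot (y - (rho * Num.sqrt N%:R) *: p) (y - (rho * Num.sqrt N%:R) *: p) <=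
      2 * N%:R -> `|diffop step a (f j) y - df a j p| <= eta.
  by apply: Hp; rewrite le_max lexx.
have [Nq HNq] : exists N0, forall N, (N0 <= N)%N -> forall y,
    dot (y - (rho * Num.sqrt N%:R) *: q) (y - (rho * Num.sqrt N%:R) *: q) <=
      2 * N%:R -> `|diffop step a (f j) y - df a j q| <= eta.
  by apply: Hq; rewrite le_max lexx orbT.
(* [|w - c|^2 <= 2 |w|^2 + 2 |c|^2], where [|w|^2 = rho^2 N] and
   [|c|^2 <= N + 1 <= 2 N] *)
pose D := 2 * rho ^+ 2 + 4.
have D0 : 0 < D by rewrite ltr_wpDl // mulr_ge0 // sqr_ge0.
have d0 : 0 < d by rewrite ltr0n.
pose g := diffop step a (f j).
pose gap := ((df a j q - eta - (df a j p + eta)) / 2) ^+ 2 / (4 * expR (d * D)).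
have gap0 : 0 < gap.
  have b0 : 0 < (df a j q - eta - (df a j p + eta)) / 2.
    by apply: divr_gt0 => //; rewrite /eta; lra.
  by rewrite /gap divr_gt0 // ?exprn_gt0 // mulr_gt0 // expR_gt0.
exists ((2 * d)^-1 * gap); first by rewrite mulr_gt0 // invr_gt0 mulr_gt0.
exists (maxn (maxn Np Nq) (Num.bound (d ^+ 2 * D)).+1) => N.
rewrite !geq_max => /andP[/andP[NpN NqN] NdN] c cN.
have N0 : (0 < N)%N by exact: leq_ltn_trans NdN.
have NR : 1 <= N%:R :> R by rewrite ler1n.
have dN : d ^+ 2 * D <= N%:R.
  apply: (@le_trans _ _ (Num.bound (d ^+ 2 * D))%:R); last by rewrite ler_nat ltnW.
  by apply: ltW; apply: archi_boundP; rewrite mulr_ge0 ?sqr_ge0 // ltW.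
have far x : sphere x -> dot ((rho * Num.sqrt N%:R) *: x - c)
    ((rho * Num.sqrt N%:R) *: x - c) <= D * N%:R.
  move=> x1; set w := _ *: x.
  have ww : dot w w = rho ^+ 2 * N%:R.
    by rewrite dot_scale2 x1 mulr1 exprMn sqr_sqrtr.
  have := dot_sqrD w (- c); have := dot_sqrD w c; have := dot_ge0 (w + c).
  have dotN (u v : 'rV[R]_m.+1) : dot u (- v) = - dot u v.
    by rewrite dotC -scaleN1r dotZl mulN1r dotC.
  rewrite !dotN (dotC (- c)) dotN ww -natr1 /D in cN *; nra.
have V : gap <= srwn N (fun y => g y ^+ 2) c - srwn N g c ^+ 2.
  apply: (srw_variance_ge N0 dN (far p p1) (far q q1)).
  - by rewrite /eta; lra.
  - by move=> y /(HNp _ NpN); rewrite ler_norml -/(g y) => /andP[_]; lra.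
  - by move=> y /(HNq _ NqN); rewrite ler_norml -/(g y) => /andP[]; lra.
have term j' : 0 <= srwn N (carre step unif (f j')) c - carre step unif (srwn N (f j')) c.
  by rewrite subr_ge0; apply: carre_walkn_le; [exact: unif_ge0|exact: unif_sum].
rewrite /energy walkn_sum -sumrB (bigD1 j) //=.
apply: ler_wpDr; first by apply: sumr_ge0 => j' _.
rewrite walkn_carre carreE -sumrB (bigD1 a) //=.
apply: ler_wpDr.
  apply: sumr_ge0 => b _; rewrite -mulrBr mulr_ge0 ?unif_ge0 // subr_ge0 diffop_walkn.
  by apply: walkn_sqr_le; [exact: unif_ge0|exact: unif_sum].
by rewrite -mulrBr diffop_walkn ler_wpM2l // invr_ge0 mulr_ge0.
Qed.

(** By [f_norm] the mean of [|f|^2] is [|c|^2 + N + 1], and by [poincare] the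
    variance of [f] exceeds [N + 1] by at most [eps (N + 1)], which is less than
    [|c|^2] when [c] is large; when [c] is small, the gap of [srw_energy_gap]
    makes the variance smaller than [N + 1]. *)
Lemma srw_nonvanishing p q a j : sphere p -> sphere q -> df a j p < df a j q ->
  exists N, forall c, 0 < \sum_j srwn N.+1 (f j) c ^+ 2.
Proof.
move=> p1 q1 pq; have [kap kap0 [N1 H1]] := srw_energy_gap p1 q1 pq.
pose eps := Num.min (kap / 4) 2^-1.
have eps0 : 0 < eps by rewrite lt_min divr_gt0 //= invr_gt0.
have epsk : eps <= kap / 4 by rewrite ge_min lexx.
have epsh : eps <= 2^-1 by rewrite ge_min lexx orbT.
have [N2 H2] := srw_energy_le eps0.
pose N := maxn N1 N2; exists N => c.
have U0 := @unif_ge0 R m; have U1 := @unif_sum R m.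
have NR : 0 < N.+1%:R :> R by rewrite ltr0n.
have H2c := H2 N (leq_maxr _ _) c.
set E := srwn N energy c in H2c.
pose G := \sum_j carre step unif (srwn N (f j)) c.
have GE : G <= E.
  by rewrite /E /energy walkn_sum; apply: ler_sum => k _; exact: carre_walkn_le.
have P : dot c c + N.+1%:R - \sum_j srwn N.+1 (f j) c ^+ 2 <= N.+1%:R / 2 * (E + G).
  rewrite -srw_norm2 -(_ : srwn N.+1 (fun y => \sum_j f j y ^+ 2) c =
    srwn N.+1 (fun y => dot y y) c); last by congr (iter _ _ _ _); apply/funext.
  rewrite walkn_sum -sumrB /E /G /energy walkn_sum -big_split mulr_sumr /=.
  by apply: ler_sum => k _; exact: poincare.
have [cN|cN] := leP (dot c c) N.+1%:R.
  have := H1 N (leq_maxl _ _) c cN; rewrite -/E -/G => gap.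
  have := dot_ge0 c; nra.
nra.
Qed.

End Bounds.
End Energy.

(** * The homotopy *)

Section ScaledWalk.
Variables (R : realType) (k : nat) (I : finType).
Variables (X : I -> 'rV[R]_k) (p : I -> R).

Lemma walkn_scaled N (s : R) (g : 'rV[R]_k -> R) y :
  iter N (walk (fun a => s *: X a) p) g (s *: y) =
  iter N (walk X p) (fun z => g (s *: z)) y.
Proof.
elim: N y => //= N IH y; apply: eq_bigr => a _.
by rewrite -scalerDr IH.
Qed.

Lemma walkn_scaled_continuous N (g : 'rV[R]_k -> R) : continuous g ->
  continuous (fun z : R * 'rV[R]_k => iter N (walk (fun a => z.1 *: X a) p) g z.2).
Proof.
move=> cg; elim: N => [|N IH] z.
  apply: (@continuous_comp _ _ _ snd g); [exact: cvg_snd|exact: cg].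
apply: (@cvg_big _ _ _ _ xpredT add_continuous _ (nbhs z) _ _ _ (nbhs_filter z)) => a _.
apply: cvgM; first exact: cvg_cst.
pose h (w : R * 'rV[R]_k) := (w.1, w.2 + w.1 *: X a).
apply: (@continuous_comp _ _ _ h
  (fun z : R * 'rV[R]_k => iter N (walk (fun a => z.1 *: X a) p) g z.2)); last exact: IH.
have c2 : {for z, continuous (fun w : R * 'rV[R]_k => w.2 + w.1 *: X a)}.
  apply: cvgD; first exact: cvg_snd.
  by apply: cvgZr_tmp; exact: cvg_fst.
have c1 : {for z, continuous (fun w : R * 'rV[R]_k => w.1)} by exact: cvg_fst.
exact: (cvg_pair c1 c2).
Qed.

End ScaledWalk.

Lemma radial_proj_continuous (R : realType) n (x : 'rV[R]_n.+1) : x != 0 ->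
  {for x, continuous (@radial_proj R n)}.
Proof.
rewrite -dot_gt0 => x0; have c := C1_at_continuous (C1_at_invnorm x0).
have cid : {for x, continuous (fun y : 'rV[R]_n.+1 => y)} by [].
exact: (cvgZ c cid).
Qed.

Section Main.
Variables (R : realType) (m n : nat) (F : 'rV[R]_m.+1 -> 'rV[R]_n.+1).
Hypothesis sF : smooth_sphere_map F.

Notation f := (fun j y => hext F y 0 j).

(** At the origin the extension is continuous because it preserves norms. *)
Lemma hext_continuous j : continuous (f j).
Proof.
move=> y; have [->|y0] := eqVneq y 0.
  have f0 : f j 0 = 0 by rewrite -[X in hext F X](scale0r 0) hextZ // mxE mul0r.
  suff H : f j z @[z --> (0 : 'rV[R]_m.+1)] --> (0 : R) by rewrite -f0 in H.
  apply: (iffRL (@cvgr0Pnorm_lt R R _ _ (nbhs_filter (0 : 'rV[R]_m.+1)) _)) => e e0.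
  have : {for (0 : 'rV[R]_m.+1), continuous (fun y : 'rV[R]_m.+1 => dot y y)}.
    exact: C1_at_continuous (C1_at_dot _).
  move=> /cvgr_lt/(_ (e ^+ 2)); rewrite dotE mul0mx mxE exprn_gt0 // => /(_ isT).
  apply: filterS => z ze; rewrite -(@ltr_pXn2r _ 2) ?nnegrE ?(ltW e0) //.
  rewrite real_normK ?num_real //; apply: le_lt_trans ze.
  by rewrite -(hext_norm z sF.1); exact: dot_coord_le.
pose r := Num.sqrt (dot y y).
have r0 : 0 < r by rewrite sqrtr_gt0 dot_gt0.
have fE : f j = (fun z => r * f j (r^-1 *: z)).
  apply/funext => z; have r1 : 0 <= r^-1 by rewrite invr_ge0 ltW.
  by rewrite (hextZ F z r1) [(_ *: hext F z) _ _]mxE mulrA divff ?mul1r ?gt_eqF.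
have S1 : unit_sphere R m (r^-1 *: y) := radial_proj_sphere y0.
have c1 : {for y, continuous (fun z : 'rV[R]_m.+1 => r^-1 *: z)}.
  exact: scaler_continuous.
have c2 : {for y, continuous (fun z : 'rV[R]_m.+1 => f j (r^-1 *: z))}.
  exact: (@continuous_comp _ _ _ (fun z : 'rV[R]_m.+1 => r^-1 *: z) (f j) y c1
    (C1_at_continuous (C1_at_hext j sF S1))).
have c3 : {for y, continuous (fun _ : 'rV[R]_m.+1 => r)} by exact: cst_continuous.
have c4 : {for y, continuous (fun z : 'rV[R]_m.+1 => r * f j (r^-1 *: z))} .
  exact: (cvgM c3 c2).
by rewrite -fE in c4.
Qed.

(** At time [s] the walk with steps of size [s] starts at [(1 - s) x]: for [s = 0]
    it stands still at [x], for [s = 1] its start is the origin. For [s > 0]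
    homogeneity reduces the average to that of the walk with unit steps. *)
Lemma nonvanishing_homotopically_trivial N :
  (forall c, 0 < \sum_j iter N (walk (@step R m) (@unif R m)) (f j) c ^+ 2) ->
  homotopically_trivial F.
Proof.
move=> pos.
pose U (s : R) j := iter N (walk (fun a => s *: @step R m a) (@unif R m)) (f j).
pose G (z : R * 'rV[R]_m.+1) : 'rV[R]_n.+1 := \row_j U z.1 j ((1 - z.1) *: z.2).
have U0 j y : U 0 j y = f j y.
  rewrite /U; elim: N {pos U G} y => //= N IH y; rewrite /walk.
  under eq_bigr do rewrite scale0r addr0 IH.
  by rewrite -mulr_suml unif_sum mul1r.
have Us (s : R) j y : 0 < s ->
    U s j y = s * iter N (walk (@step R m) (@unif R m)) (f j) (s^-1 *: y).
  move=> s0; have {1}-> : y = s *: (s^-1 *: y) by rewrite scalerA divff ?gt_eqF // scale1r.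
  rewrite /U walkn_scaled.
  have -> : (fun z => f j (s *: z)) = (fun z => s * f j z).
    apply/funext => z; rewrite hextZ; last exact: ltW.
    by rewrite [LHS]mxE.
  by rewrite walknZ.
have G0 x : unit_sphere R m x -> G (0, x) = F x.
  by move=> x1; apply/rowP => j; rewrite mxE /= U0 subr0 scale1r hext_sphere.
have Gn0 s x : 0 <= s -> unit_sphere R m x -> G (s, x) != 0.
  move=> s_ge0 x1; rewrite -dot_gt0; move: s_ge0.
  rewrite le_eqVlt => /orP[/eqP <-|s0]; first by rewrite G0 //; have /= -> := sF.1 x x1.
  rewrite /dot; under eq_bigr do rewrite !mxE /= Us // -expr2 exprMn.
  by rewrite -mulr_sumr mulr_gt0 // exprn_gt0.
have cG : continuous G.
  move=> z; pose k (z : R * 'rV[R]_m.+1) : R * 'rV[R]_m.+1 := (z.1, (1 - z.1) *: z.2).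
  have ck : {for z, continuous k}.
    have k1 : {for z, continuous (fun z : R * 'rV[R]_m.+1 => z.1)} by exact: cvg_fst.
    have k2 : {for z, continuous (fun z : R * 'rV[R]_m.+1 => z.2)} by exact: cvg_snd.
    have k3 : {for z, continuous (fun z : R * 'rV[R]_m.+1 => 1 - z.1)}.
      by apply: cvgB => //; exact: cvg_cst.
    have k4 : {for z, continuous (fun z : R * 'rV[R]_m.+1 => (1 - z.1) *: z.2)}.
      exact: (cvgZ k3 k2).
    exact: (cvg_pair k1 k4).
  have GE : G = (fun z => \sum_j (U (k z).1 j (k z).2) *: delta_mx 0 j).
    apply/funext => w; rewrite [LHS]row_sum_delta.
    by apply: eq_bigr => j _; rewrite mxE.
  rewrite GE.
  apply: (@cvg_big _ _ _ _ xpredT add_continuous _ (nbhs z) _ _ _ (nbhs_filter z)) => j _.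
  have cU : {for k z, continuous (fun z : R * 'rV[R]_m.+1 => U z.1 j z.2)}.
    exact: (@walkn_scaled_continuous _ _ _ (@step R m) (@unif R m) N _ (@hext_continuous j)).
  have cUk : {for z, continuous (fun w => U (k w).1 j (k w).2)}.
    exact: (@continuous_comp _ _ _ k (fun z : R * 'rV[R]_m.+1 => U z.1 j z.2) z ck cU).
  by apply: cvgZr_tmp; exact: cUk.
exists (fun z => radial_proj (G z)), (radial_proj (\row_j U 1 j 0)); split.
- apply: continuous_in_subspaceT => -[s x]; rewrite inE => -[/= s01 x1].
  apply: continuous_comp; first exact: cG.
  apply: radial_proj_continuous; apply: Gn0 => //.
  by move: s01; rewrite in_itv /= => /andP[].
- move=> [s x] [/= s01 x1]; apply: radial_proj_sphere; apply: Gn0 => //.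
  by move: s01; rewrite in_itv /= => /andP[].
- by move=> x x1; rewrite G0 // radial_projK //; exact: (sF.1 _ x1).
- move=> x x1; congr radial_proj; apply/rowP => j.
  by rewrite !mxE /= subrr scale0r.
Qed.

End Main.

(** * Linear extensions *)

Lemma mulmxr_continuous (R : realType) p q (A : 'M[R]_(p, q)) :
  continuous (fun y : 'rV[R]_p => y *m A).
Proof.
move=> y; have -> : (fun y : 'rV[R]_p => y *m A) = (fun y => \sum_i y 0 i *: row i A).
  by apply/funext => z; rewrite mulmx_sum_row.
apply: (@cvg_big _ _ _ _ xpredT add_continuous _ (nbhs y) _ _ _ (nbhs_filter y)) => i _.
by apply: cvgZr_tmp; exact: coord_continuous.
Qed.

Section Linear.
Variables (R : realType) (m n : nat) (F : 'rV[R]_m.+1 -> 'rV[R]_n.+1).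
Hypothesis sF : smooth_sphere_map F.

(** A linear map preserving the norm on the sphere preserves inner products by
    polarization, so that [A *m A^T = 1] and [A^T] inverts it; the great
    subsphere is cut out by its image. *)
Lemma linear_great_isometry (A : 'M[R]_(m.+1, n.+1)) :
  (forall x, unit_sphere R m x -> F x = x *m A) ->
  isometric_embedding F /\ great_subsphere (F @` unit_sphere R m).
Proof.
move=> FA.
have norm_A y : dot (y *m A) (y *m A) = dot y y.
  have [->|y0] := eqVneq y 0; first by rewrite mul0mx !dotE !mul0mx !mxE.
  have S1 := radial_proj_sphere y0; have /= := sF.1 _ S1.
  rewrite /unit_sphere /= FA // /radial_proj -scalemxAl dot_scale2 exprVn.
  rewrite sqr_sqrtr ?dot_ge0 // => E.
  by rewrite -[RHS]mulr1 -E mulrA divff ?mul1r // gt_eqF // dot_gt0.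
have dot_A u v : dot (u *m A) (v *m A) = dot u v.
  have := norm_A (u + v); rewrite mulmxDl !dot_sqrD !norm_A; lra.
have AA : A *m A^T = 1%:M.
  apply/matrixP => i j.
  have -> : (A *m A^T) i j = (row i A *m A^T) 0 j by rewrite -row_mul [RHS]mxE.
  rewrite mulmx_trE !rowE dot_A dotE trmx_delta mul_delta_mx_cond mulmxnE !mxE.
  by rewrite !eqxx.
split; last first.
  exists (limg (linfun (mulmxr A : 'rV[R]_m.+1 -> 'rV[R]_n.+1))).
  apply/seteqP; split => [y [x x1 <-]|y [y1 /memv_imgP[x _ yE]]].
    split; first exact: (sF.1 x x1).
    by rewrite /= FA //; apply/memv_imgP; exists x; rewrite ?memvf // lfunE.
  move: yE; rewrite lfunE /= => yE.
  have x1 : unit_sphere R m x by rewrite /unit_sphere /= -norm_A -yE.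
  by exists x => //; rewrite FA.
split.
  have dA x v : unit_sphere R m x -> tangent x v -> sphere_diff F x v = v *m A.
    move=> x1 xv; pose L : {linear 'rV[R]_m.+1 -> 'rV[R]_n.+1} := mulmxr A.
    have cL : continuous L by exact: mulmxr_continuous.
    have dL : differentiable L x by exact: linear_differentiable.
    have E := congr1 (fun h => h v) (@diff_lin _ _ _ L x cL).
    apply: (etrans _ E).
    apply: (@sphere_diffE R m n F L setT x v) => //; first exact: openT.
    by move=> y _ y1; rewrite FA.
  by move=> x u v x1 xu xv; rewrite !dA.
exists (fun y => y *m A^T); split.
  by move=> x x1; rewrite FA // -mulmxA AA mulmx1.
by apply: continuous_subspaceT; exact: mulmxr_continuous.
Qed.

End Linear.

Theorem corollary5p2 (R : realType) (m n : nat)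
    (F : 'rV[R]_m.+1 -> 'rV[R]_n.+1)
    (smoothF : smooth_sphere_map F)
    (normF : forall x : 'rV[R]_m.+1, unit_sphere R m x ->
       sq_norm_diff F x <= (minn n m)%:R) :
  (isometric_embedding F /\ great_subsphere (F @` unit_sphere R m)) \/
  homotopically_trivial F.
Proof.
pose f j (y : 'rV[R]_m.+1) := hext F y 0 j.
pose df (a : 'I_m.+1 * bool) j x : R := 'd (f j) x (@step R m a).
have step0 i : @step R m (i, false) = delta_mx 0 i by rewrite /step expr0 scale1r.
have step1 i : @step R m (i, true) = - delta_mx 0 i by rewrite /step expr1 scaleN1r.
have f_norm y : \sum_j f j y ^+ 2 = dot y y.
  by rewrite -(hext_norm y smoothF.1); apply: eq_bigr => j _; rewrite expr2.
have fZ j (r : R) y : 0 <= r -> f j (r *: y) = r * f j y.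
  by move=> r0; rewrite /f hextZ // [LHS]mxE.
have df_near x a j (eta : R) : unit_sphere R m x -> 0 < eta ->
    \forall u \near x & t \near 0^'+,
      `|f j (u + t *: @step R m a) - f j u - t * df a j x| <= eta * t.
  by move=> x1 eta0; exact: C1_at_increment (C1_at_hext j smoothF x1) eta0.
have df_energy x : unit_sphere R m x -> \sum_a \sum_j df a j x ^+ 2 <= 2 * m.+1%:R.
  move=> x1; rewrite (sum_step (fun a => \sum_j df a j x ^+ 2)).
  have -> : \sum_i (\sum_j df (i, false) j x ^+ 2 + \sum_j df (i, true) j x ^+ 2) =
      2 * \sum_i \sum_j 'd (fun y => hext F y 0 j) x (delta_mx 0 i) ^+ 2.
    rewrite mulr_sumr; apply: eq_bigr => i _.
    rewrite mulr_sumr -big_split /=; apply: eq_bigr => j _.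
    by rewrite /df step0 step1 linearN sqrrN mulr2n mulrDl !mul1r.
  rewrite diff_hext_sqr // ler_wpM2l // -natr1 addrC lerD2r.
  by apply: le_trans (normF x x1) _; rewrite ler_nat geq_minr.
have [[p [q [a [j [p1 q1 pq]]]]]|const] := pselect (exists p q a j,
    [/\ unit_sphere R m p, unit_sphere R m q & df a j p < df a j q]).
  right; have [N posN] := srw_nonvanishing f_norm fZ df_near df_energy p1 q1 pq.
  exact: nonvanishing_homotopically_trivial posN.
left; pose e0 : 'rV[R]_m.+1 := delta_mx 0 0.
have e01 : unit_sphere R m e0.
  by rewrite /unit_sphere /= /e0 -(step0 0) dot_step1.
have matrix_of (g : 'I_m.+1 -> 'I_n.+1 -> R) :
    exists A : 'M[R]_(m.+1, n.+1), forall i j, A i j = g i j.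
  by exists (\matrix_(i, j) g i j) => i j; rewrite mxE.
have [A AE] := matrix_of (fun i j => df (i, false) j e0).
apply: (linear_great_isometry smoothF (A := A)) => x x1.
apply/rowP => j; rewrite -(hext_sphere F x1) -(diff_hext_radial j smoothF x1).
rewrite [X in 'd _ _ X]row_sum_delta linear_sum mxE; apply: eq_bigr => i _.
have dfE : 'd (f j) x (delta_mx 0 i) = df (i, false) j x by rewrite /df step0.
have key (a b : R) : ~ a < b -> ~ b < a -> a = b by case: ltgtP.
have constE : df (i, false) j x = df (i, false) j e0.
  apply: key => lt; apply: const; first by exists x, e0, (i, false), j.
  by exists e0, x, (i, false), j.
rewrite AE -constE -dfE.
rewrite linearZ; exact: erefl.
Qed.
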